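(* Let $\mathcal X_i=\Delta^{d_i}$ for all $i$. Let $G$ be one of the following: (1) the $\alpha$-divergence $G(\pi_i,\sigma_i)=\frac{1}{\alpha(1-\alpha)}\big(1-\sum_{j=1}^{d_i}\pi_{ij}^{\alpha}\sigma_{ij}^{1-\alpha}\big)$ with $\alpha\in(0,1)$; (2) the Rényi divergence $G(\pi_i,\sigma_i)=\frac{1}{\alpha-1}\ln\big(\sum_{j=1}^{d_i}\pi_{ij}^{\alpha}\sigma_{ij}^{1-\alpha}\big)$ with $\alpha\in(0,1)$; (3) the reverse KL divergence $G(\pi_i,\sigma_i)=\mathrm{KL}(\sigma_i,\pi_i)=\sum_j\sigma_{ij}\ln(\sigma_{ij}/\pi_{ij})$. Fix $\mu>0$, let $\sigma^0$ lie in the interior of $\mathcal X$, and define $\sigma^{k+1}=\pi^{\mu,\sigma^k}$ for $k\ge0$. Then $\sigma^k$ converges to the set $\Pi^*$ of Nash equilibria, in the sense that $\min_{\pi^*\in\Pi^*}\mathrm{KL}(\pi^*,\sigma^k)\to0$ as $k\to\infty$.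
   Context: Game. Let $N\ge1$. $\Delta^d=\{p\in[0,1]^d:\sum_jp_j=1\}$ denotes the probability simplex, and $\mathcal X=\prod_i\mathcal X_i$. Each $v_i:\mathcal X\to\mathbb R$ is differentiable, with block gradient $\nabla_{\pi_i}v_i$. The game is monotone: $\sum_i\langle\nabla_{\pi_i}v_i(\pi)-\nabla_{\pi_i}v_i(\pi'),\pi_i-\pi_i'\rangle\le0$ for all $\pi,\pi'$. A Nash equilibrium is a $\pi^*$ with $v_i(\pi^* )\ge v_i(\pi_i,\pi^*_{-i})$ for all $i$ and $\pi_i\in\mathcal X_i$. $\Pi^*$ is the set of Nash equilibria. KL divergence: $\mathrm{KL}(\pi,\pi')=\sum_i\sum_j\pi_{ij}\ln(\pi_{ij}/\pi'_{ij})$. Perturbed equilibrium. For $\mu>0$ and $\sigma\in\mathcal X$, $\pi^{\mu,\sigma}$ is the profile with $\pi_i^{\mu,\sigma}\in\arg\max_{\pi_i\in\mathcal X_i}\{v_i(\pi_i,\pi^{\mu,\sigma}_{-i})-\mu G(\pi_i,\sigma_i)\}$ for all $i$. *)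

(* Defs.v *)
From HB Require Import structures.
From mathcomp Require Import all_boot all_order all_algebra.
From mathcomp Require Import all_classical all_reals all_analysis.
Set Implicit Arguments. Unset Strict Implicit. Unset Printing Implicit Defensive.
Import Order.TTheory GRing.Theory Num.Theory.
Import numFieldNormedType.Exports.
Local Open Scope classical_set_scope.
Local Open Scope ring_scope.

(* Setup: N players, total dimension n; coordinate j : 'I_n belongs to player
   [owner j].  A profile is a row vector pi : 'rV[R]_n, player i's mixed
   strategy pi_i is the block (pi 0 j)_{owner j = i}, of dimension
   d_i = #|{j | owner j = i}|.  X_i = simplex on that block. *)

Section Game.
Variables (R : realType) (N n : nat) (owner : 'I_n -> 'I_N).

Definition in_simplex_i (i : 'I_N) (pi : 'rV[R]_n) : Prop :=
  (forall j, owner j = i -> 0 <= pi 0 j) /\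
  \sum_(j | owner j == i) pi 0 j = 1.

Definition in_X (pi : 'rV[R]_n) : Prop := forall i, in_simplex_i i pi.

Definition in_interior_X (pi : 'rV[R]_n) : Prop :=
  in_X pi /\ forall j, 0 < pi 0 j.

Definition unilateral (i : 'I_N) (pi p : 'rV[R]_n) : Prop :=
  in_simplex_i i p /\ forall j, owner j != i -> p 0 j = pi 0 j.

Definition grad_comp (v : 'I_N -> 'rV[R]_n -> R) (pi : 'rV[R]_n) (j : 'I_n) : R :=
  'd (v (owner j)) pi (delta_mx 0 j).

Definition monotone_game (v : 'I_N -> 'rV[R]_n -> R) : Prop :=
  forall pi pi', in_X pi -> in_X pi' ->
    \sum_i \sum_(j | owner j == i)
       (grad_comp v pi j - grad_comp v pi' j) * (pi 0 j - pi' 0 j) <= 0.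

Definition nash (v : 'I_N -> 'rV[R]_n -> R) (pi : 'rV[R]_n) : Prop :=
  in_X pi /\ forall i p, unilateral i pi p -> v i p <= v i pi.

Definition nash_set (v : 'I_N -> 'rV[R]_n -> R) : set 'rV[R]_n := [set pi | nash v pi].

(* a * ln (a / b) with the conventions 0 ln(0/b) = 0 and a ln(a/0) = +oo (a > 0) *)
Definition xlogxy (a b : R) : \bar R :=
  if a == 0 then 0%E else if 0 < b then (a * ln (a / b))%:E else +oo%E.

Definition KL (pi pi' : 'rV[R]_n) : \bar R :=
  (\sum_(j < n) xlogxy (pi ord0 j) (pi' ord0 j))%E.

Inductive divergence := AlphaDiv of R | RenyiDiv of R | ReverseKL.

Definition alpha_ok (D : divergence) : Prop :=
  match D with
  | AlphaDiv a => 0 < a < 1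
  | RenyiDiv a => 0 < a < 1
  | ReverseKL => True
  end.

Definition hellsum (a : R) (i : 'I_N) (p s : 'rV[R]_n) : R :=
  \sum_(j | owner j == i) (p 0 j `^ a) * (s 0 j `^ (1 - a)).

Definition Gdiv (D : divergence) (i : 'I_N) (p s : 'rV[R]_n) : \bar R :=
  match D with
  | AlphaDiv a => ((1 - hellsum a i p s) / (a * (1 - a)))%:E
  | RenyiDiv a =>
      if 0 < hellsum a i p s then (ln (hellsum a i p s) / (a - 1))%:E
      else +oo%E  (* (1/(a-1)) * ln 0 = (-oo)/(negative) = +oo *)
  | ReverseKL => (\sum_(j | owner j == i) xlogxy (s ord0 j) (p ord0 j))%E
  end.

Definition pert_obj (v : 'I_N -> 'rV[R]_n -> R) (D : divergence) (mu : R)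
  (sigma : 'rV[R]_n) (i : 'I_N) (p : 'rV[R]_n) : \bar R :=
  ((v i p)%:E - mu%:E * Gdiv D i p sigma)%E.

Definition perturbed_eq (v : 'I_N -> 'rV[R]_n -> R) (D : divergence) (mu : R)
  (sigma pi : 'rV[R]_n) : Prop :=
  in_X pi /\
  forall i p, unilateral i pi p ->
    (pert_obj v D mu sigma i p <= pert_obj v D mu sigma i pi)%E.

End Game.

(* Main.v *)
Require Import Defs.
From HB Require Import structures.
From mathcomp Require Import all_boot all_order all_algebra.
From mathcomp Require Import all_classical all_reals all_analysis.
From mathcomp Require Import ring lra zify.
Set Implicit Arguments. Unset Strict Implicit. Unset Printing Implicit Defensive.
Import Order.TTheory GRing.Theory Num.Theory.
Import numFieldNormedType.Exports.
Local Open Scope classical_set_scope.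
Local Open Scope ring_scope.

(* Write A_j(p) for the gain rate of the owner of coordinate j when moving from
   p towards the pure strategy j.  For each of the three divergences,
   optimality against such moves makes p = sigma^(k+1) interior and gives, with
   s = sigma^k,
     A_j(p) <= c (1 - (s_j / p_j)^b)   for constants b, c > 0,
   so that ln p_j - ln s_j >= A_j(p) / (c b).

   Combined with monotonicity this bounds the decrease of KL(x, sigma^k) for
   every x.  A cluster point y of the averages of sigma^k satisfies Minty's
   inequality; for x = y the divergence is nonincreasing, which forces
   sigma_j^(k+1) / sigma_j^k -> 1 on the support of y, while the mass off
   the support is arbitrarily small arbitrarily late and varies slowly.  Some
   limit point x of sigma^k is thus supported in supp y and has A_j(x) <= 0
   there; no continuity of the gradients is available to compare x and y.

   Where A_j(x) > 0, the mass sigma_j^k grows geometrically as long as sigma^k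
   is near x, so the mass accumulated during a stay near x is controlled by its
   last term, hence by the slowly varying mass off the support.  As
   KL(x, sigma^k) can only increase through such coordinates, it tends to 0
   (induction on the set of coordinates whose accumulated mass is not known to
   be small).  Then A_j(x) > 0 would make sigma_j^k unbounded, so x is Nash. *)

(** Real inequalities, ring equalities and quantified hypotheses are dropped, so that [lia] sees
    only the index arithmetic. *)
Ltac nat_lia :=
  repeat match goal with
  | H : is_true (@Order.lt _ _ _ _) |- _ => clear H
  | H : is_true (@Order.le _ _ _ _) |- _ => clear H
  | H : @eq (GRing.Zmodule.sort _) _ _ |- _ => clear H
  | H : forall _, _ |- _ => clear H
  | x := _ |- _ =>
    lazymatch type of x with nat => fail | _ => first [clear x | clearbody x] end
  end; lia.

Lemma exprn_ge_bernoulli (R : realFieldType) (q : R) m : 0 <= q ->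
  1 + (q - 1) * m%:R <= q ^+ m.
Proof.
move=> q0; elim: m => [|m IH]; first by rewrite mulr0 addr0.
rewrite exprS -natr1; have := mulr_ge0 (sqr_ge0 (q - 1)) (ler0n R m).
have := ler_wpM2l q0 IH; nra.
Qed.

(** * Trapping: a quantity that gets small late enough stays small *)

Section Trapping.
(** In the application [f k] is KL(x, sigma^k), [u k] lists the coordinates of sigma^k, [gam] the
    gain rates at x, and [th k] is the mass of sigma^k off the support of y. *)
Variables (R : realType) (n : nat) (f th : nat -> R) (u : nat -> 'I_n -> R).
Variables (gam : 'I_n -> R) (C : R).
Hypothesis C_ge0 : 0 <= C.
Hypothesis u_ge0 : forall k j, 0 <= u k j.
Hypothesis f_step : forall k, f k.+1 <= f k + C * \sum_j gam j * u k.+1 j.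
Hypothesis u_growth : forall j, 0 < gam j -> exists2 r, 0 < r &
  exists2 q, 1 < q & forall k, f k.+1 < r -> q * u k j <= u k.+1 j.
Hypothesis u_le_th : forall k j, 0 < gam j -> u k j <= th k.
Hypothesis th_small : forall e, 0 < e ->
  exists2 d, 0 < d & forall k, f k < d -> th k < e.
Hypothesis th_slow : forall e, 0 < e ->
  exists K, forall k, (K <= k)%N -> th k.+1 <= th k + e.

Let mass s t j := \sum_(s <= k < t) u k.+1 j.

Lemma mass_ge0 s t j : 0 <= mass s t j.
Proof. by apply: sumr_ge0 => k _; exact: u_ge0. Qed.

Lemma mass_le s m t j : (m <= t)%N -> mass s m j <= mass s t j.
Proof.
move=> mt; have [sm|ms] := leqP s m.
  by rewrite /mass (big_cat_nat sm mt) /= lerDl; exact: mass_ge0.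
by rewrite {1}/mass big_geq ?(ltnW ms)//; exact: mass_ge0.
Qed.

(** A geometrically growing sum is dominated by its last term: inductively, the mass so far, times
    [q - 1], is at most the next term. *)
Lemma mass_geometric q s t j : 1 < q -> (s <= t)%N ->
  (forall k, (s <= k < t)%N -> q * u k j <= u k.+1 j) ->
  (q - 1) * mass s t j <= q * u t j.
Proof.
move=> q1 /subnKC <-; elim: (t - s)%N => [|m IH] grow.
  by rewrite /mass addn0 big_geq// mulr0 mulr_ge0// ltW// (lt_trans ltr01).
rewrite addnS /mass big_nat_recr ?leq_addr//= -/(mass _ _ _) mulrDr.
have /grow : (s <= s + m < s + m.+1)%N by nat_lia.
have /IH : forall k, (s <= k < s + m)%N -> q * u k j <= u k.+1 j.
  by move=> k ?; apply: grow; nat_lia.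
by nra.
Qed.

Lemma geometric_le q s t j : 0 <= q -> (s <= t)%N ->
  (forall k, (s <= k < t)%N -> q * u k j <= u k.+1 j) ->
  q ^+ (t - s) * u s j <= u t j.
Proof.
move=> q0 /subnKC <-; rewrite addKn; elim: (t - s)%N => [|m IH] grow.
  by rewrite addn0 mul1r.
rewrite addnS exprS -mulrA; have /grow : (s <= s + m < s + m.+1)%N by nat_lia.
apply: le_trans; rewrite ler_wpM2l//; apply: IH => k ?; apply: grow; nat_lia.
Qed.

Lemma th_drift K e m k : (K <= k)%N ->
  (forall l, (K <= l)%N -> th l.+1 <= th l + e) -> th (k + m)%N <= th k + m%:R * e.
Proof.
move=> Kk slow; elim: m => [|m IH]; first by rewrite addn0 mul0r addr0.
have /slow : (K <= k + m)%N by nat_lia.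
by rewrite addnS => /le_trans; apply; rewrite -natr1 mulrDl mul1r addrA lerD2r.
Qed.

Lemma f_drift s t : (s <= t)%N ->
  f t <= f s + C * \sum_j gam j * mass s t j.
Proof.
move=> /subnKC <-; elim: (t - s)%N => [|m IH].
  rewrite addn0 (eq_bigr (fun=> 0)) ?sumr_const ?mul0rn ?mulr0 ?addr0//.
  by move=> j _; rewrite /mass big_geq// mulr0.
rewrite addnS; apply: le_trans (f_step _) _.
have -> : \sum_j gam j * mass s (s + m).+1 j =
    \sum_j gam j * mass s (s + m) j + \sum_j gam j * u (s + m).+1 j.
  rewrite -big_split/=; apply: eq_bigr => j _.
  by rewrite /mass big_nat_recr ?leq_addr//= mulrDr.
by rewrite mulrDr addrA lerD2r.
Qed.

(** Induction on the size of [A], the coordinates whose accumulated mass is not yet controlled. If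
    none of them has a positive rate, [f_drift] suffices. Otherwise one with positive rate is
    removed: its mass is shown to be small, and the induction hypothesis is used at two scales, [e1]
    and [r2]. *)
Lemma trapping_active (A : {set 'I_n}) (e : R) : 0 < e ->
  exists2 d, 0 < d & exists K, forall s t, (K <= s <= t)%N -> f s < d ->
    (forall j, j \notin A -> mass s t j < d) -> f t < e.
Proof.
have [m] := ubnP #|A|; elim: m => // m IHm in A e * => cardA e0.
have [/forallP gamA|] := boolP [forall j, (j \in A) ==> (gam j <= 0)].
  pose M := C * \sum_j `|gam j|.
  have M0 : 0 <= M by rewrite mulr_ge0// sumr_ge0.
  (* The start contributes at most [d] and the drift at most [M * d], in total [e]. *)
  exists (e / (1 + M)); first by rewrite divr_gt0//; lra.
  exists 0%N => s t /andP[_ st] fs massA.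
  apply: le_lt_trans (f_drift st) _.
  have : \sum_j gam j * mass s t j <= \sum_j `|gam j| * (e / (1 + M)).
    apply: ler_sum => j _; have [jA|jA] := boolP (j \in A).
      apply: (@le_trans _ _ 0).
        by rewrite mulr_le0_ge0 ?mass_ge0//; have := gamA j; rewrite jA.
      by rewrite mulr_ge0// divr_ge0//; lra.
    apply: (@le_trans _ _ (`|gam j| * mass s t j)).
      by rewrite ler_wpM2r ?mass_ge0// ler_norm.
    by rewrite ler_wpM2l// ltW// massA.
  rewrite -mulr_suml => /(ler_wpM2l C_ge0); rewrite mulrA -/M => H.
  have -> : e = e / (1 + M) + M * (e / (1 + M)) by field; lra.
  lra.
rewrite negb_forall => /existsP[j]; rewrite negb_imply -ltNge => /andP[jA gj].
have [r r0 [q q1 grow]] := u_growth gj.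
have cardB : (#|A :\ j| < m)%N by move: cardA; rewrite (cardsD1 j) jA; nat_lia.
(* Staying below [r] as well keeps the growth of coordinate [j] valid. *)
have e1 : 0 < Num.min e r by rewrite lt_min e0 r0.
have [d1 d10 [K1 H1]] := IHm (A :\ j) _ cardB e1.
(* If all terms are below [eta], the mass up to [t.-1] is at most [q / (q - 1) * eta]; adding the
   term at [t] gives [d1]. *)
pose eta := d1 / (q / (q - 1) + 1).
have q0 : 0 < q / (q - 1) by rewrite divr_gt0; lra.
have eta0 : 0 < eta by rewrite divr_gt0//; lra.
have eta2 : 0 < eta / 2 by rewrite divr_gt0.
have [r2 r20 thr2] := th_small eta2.
have [d2 d20 [K2 H2]] := IHm (A :\ j) _ cardB r20.
(* A coordinate that stays below [eta] after [L] growth steps had accumulated mass below [d2] before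
   them. *)
have [L HL] : exists L, q / (q - 1) * eta < q ^+ L * d2.
  have [L HL] : exists L : nat, q / (q - 1) * eta / d2 / (q - 1) < L%:R.
    by exists (Num.trunc (q / (q - 1) * eta / d2 / (q - 1))).+1; exact: truncnS_gt.
  exists L; rewrite -ltr_pdivrMr//.
  apply: (@lt_le_trans _ _ (1 + (q - 1) * L%:R)).
    by move: HL; rewrite ltr_pdivrMr; lra.
  by apply: exprn_ge_bernoulli; lra.
have eta3 : 0 < eta / (2 * L.+2%:R) by rewrite divr_gt0// mulr_gt0.
have [K3 H3] := th_slow eta3.
have eta_split : eta / 2 = L.+2%:R * (eta / (2 * L.+2%:R)).
  have : L.+2%:R != 0 :> R by rewrite pnatr_eq0.
  by move: (L.+2%:R) => y y0; field.
exists (Num.min (Num.min d1 d2) r2); first by rewrite !lt_min d10 d20 r20.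
exists (maxn (maxn K1 K2) K3) => s t /andP[Ks st].
have [K1s K2s K3s] : [/\ K1 <= s, K2 <= s & K3 <= s]%N by split; nat_lia.
rewrite !lt_min => /andP[/andP[fs1 fs2] fs3] massA.
suff: f t < Num.min e r by rewrite lt_min => /andP[].
have [p] := ubnP t; elim: p => // p IHp in t st massA * => tp.
have massA' k j' : (k <= t)%N -> j' \notin A -> mass s k j' < Num.min d1 d2.
  move=> kt /massA; rewrite !lt_min => /andP[/andP[m1 m2] _].
  by rewrite !(le_lt_trans (mass_le _ _ kt)).
have f_lt k : (s <= k < t)%N -> f k < Num.min e r.
  move=> kst; apply: IHp => [|j' j'A|]; [nat_lia| |nat_lia].
  by apply: le_lt_trans (massA _ j'A); apply: mass_le; nat_lia.
(* Growth into [k.+1] needs [f k.+1 < r], which is known only strictly before [t]; the step into [t]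
   is therefore treated separately, through [th]. *)
have growing k : (s <= k)%N -> (k.+1 < t)%N -> q * u k j <= u k.+1 j.
  move=> sk kt; apply: grow; have /f_lt : (s <= k.+1 < t)%N by nat_lia.
  by rewrite lt_min => /andP[].
have mass_j k : (s <= k < t)%N -> mass s k j <= q / (q - 1) * u k j.
  move=> kst; rewrite mulrAC ler_pdivlMr; last lra.
  by rewrite mulrC; apply: mass_geometric => [//||l ?]; [nat_lia|apply: growing; nat_lia].
have u_lt k : (s <= k <= t)%N -> u k j < eta.
  have [p'] := ubnP k; elim: p' => // p' IHu in k *.
  move=> kp' kst; apply: le_lt_trans (u_le_th k gj) _.
  have [kL|kL] := leqP k (s + L.+1).
    have := @th_drift K3 _ (k - s) s K3s H3; rewrite subnKC; last by nat_lia.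
    have : (k - s)%:R <= L.+2%:R :> R by rewrite ler_nat; nat_lia.
    move=> /(ler_wpM2r (ltW eta3)); rewrite -eta_split.
    by have := thr2 _ fs3; move: (_%:R * _) => X; lra.
  (* Growth from [w] to [k.-1] makes the mass at [w] less than [d2], so [f w < r2] and
     [th w < eta / 2]. The [L.+1] slow steps back to [k] cost less than the other half of [eta]. *)
  pose w := (k - L.+1)%N.
  have kE : k = (w + L.+1)%N by nat_lia.
  have uw : u w j * q ^+ L < eta.
    have := @geometric_le q w (w + L)%N j; rewrite addKn.
    have uL : u (w + L)%N j < eta by apply: IHu; nat_lia.
    rewrite mulrC => /(_ _ _ _)/le_lt_trans; apply => //; [lra|nat_lia|].
    by move=> l ?; apply: growing; nat_lia.
  have fw : f w < r2.
    apply: (H2 s w) => //; first by nat_lia.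
    move=> j'; rewrite !inE negb_and negbK => /orP[/eqP ->|j'A].
      apply: le_lt_trans (mass_j w _) _; first by nat_lia.
      have qL0 : 0 < q ^+ L by rewrite exprn_gt0//; lra.
      rewrite -(ltr_pM2l qL0); apply: lt_trans HL.
      rewrite mulrCA ltr_pM2l//; lra.
    by have := @massA' w j'; rewrite lt_min => /(_ _ j'A)/andP[|//]; nat_lia.
  have := @th_drift K3 _ L.+1 w _ H3; rewrite -kE => /(_ _)/le_lt_trans; apply.
    by nat_lia.
  have := thr2 _ fw.
  have : L.+1%:R <= L.+2%:R :> R by rewrite ler_nat.
  move=> /(ler_wpM2r (ltW eta3)); rewrite -eta_split.
  by move: (_%:R * _) => X; lra.
apply: (H1 s t) => //; first by nat_lia.
move=> j'; rewrite !inE negb_and negbK => /orP[/eqP ->|j'A]; last first.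
  by have := @massA' t j' (leqnn _) j'A; rewrite lt_min => /andP[].
have [<-|s't] := eqVneq s t; first by rewrite /mass big_geq.
have tE : t = t.-1.+1 by nat_lia.
rewrite tE /mass big_nat_recr/=; last by nat_lia.
rewrite -tE -/(mass _ _ _).
have := mass_j t.-1; have := u_lt t.-1; have := u_lt t.
move=> /(_ _) ut /(_ _) ut1 /(_ _) mt.
have {}ut : u t j < eta by apply: ut; nat_lia.
have {}ut1 : u t.-1 j < eta by apply: ut1; nat_lia.
have {}mt : mass s t.-1 j <= q / (q - 1) * u t.-1 j by apply: mt; nat_lia.
have -> : d1 = (q / (q - 1)) * eta + eta by rewrite /eta; field; lra.
nra.
Qed.

(* Hence [f] tends to 0 as soon as it gets arbitrarily small arbitrarily late. *)
Lemma trapping (e : R) : 0 < e ->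
  exists2 d, 0 < d & exists K, forall s t, (K <= s <= t)%N -> f s < d -> f t < e.
Proof.
move=> /(@trapping_active [set: 'I_n])[d d0 [K H]].
by exists d => //; exists K => s t st fs; apply: (H s t) => // j; rewrite inE.
Qed.

End Trapping.

(** * Elementary inequalities for logarithms, powers and entropy *)

Section RealInequalities.
Variable R : realType.
Implicit Types x s b : R.

Lemma ln_le_sub1 x : 0 < x -> ln x <= x - 1.
Proof. by move=> x0; have := @le_ln1Dx R (x - 1); rewrite [1 + _](_ : _ = x); [apply; lra|ring]. Qed.

Lemma ln_ge_1subV x : 0 < x -> 1 - x^-1 <= ln x.
Proof.
move=> x0; have := @ln_le_sub1 x^-1; rewrite invr_gt0 lnV ?posrE// => /(_ x0).
by lra.
Qed.

(* Concavity of [x `^ b] in [x], through the tangents of [expR] at [b * ln x]. *)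
Lemma powR_le_tangent1 x b : 0 < x -> 0 <= b <= 1 -> x `^ b <= 1 + b * (x - 1).
Proof.
move=> x0 /andP[b0 b1]; rewrite /powR gt_eqF//; set w := ln x.
have -> : x = expR w by rewrite lnK// posrE.
have tangent y : expR (b * w) * (1 + (y - b * w)) <= expR y.
  rewrite -[leRHS](_ : expR (b * w) * expR (y - b * w) = _).
    by rewrite ler_pM2l ?expR_gt0// expR_ge1Dx.
  by rewrite -expRD; congr expR; lra.
have := tangent w; have := tangent 0; rewrite expR0.
by have := expR_gt0 (b * w); nra.
Qed.

(** Termwise comparison of the squared Hellinger distance with relative entropy: for the square
    roots a, b of x, s, multiply ln (b / a) <= b / a - 1 by 2 a^2. *)
Lemma entropy_term_ge x s : 0 <= x -> 0 < s ->
  (Num.sqrt x - Num.sqrt s) ^+ 2 <= x * (ln x - ln s) - x + s.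
Proof.
rewrite le_eqVlt => /predU1P[<- s0|x0 s0].
  by rewrite sqrtr0 mul0r !sub0r oppr0 add0r sqrrN sqr_sqrtr ?(ltW s0).
have [a0 b0] : 0 < Num.sqrt x /\ 0 < Num.sqrt s by rewrite !sqrtr_gt0.
rewrite -[in leRHS](sqr_sqrtr (ltW x0)) -[in leRHS](sqr_sqrtr (ltW s0)).
move: (Num.sqrt x) (Num.sqrt s) a0 b0 => a b a0 b0.
rewrite !expr2 !lnM ?posrE//.
have : ln b - ln a <= b / a - 1.
  by rewrite -ln_div ?posrE// ln_le_sub1// divr_gt0.
move=> /(ler_wpM2l (ltW (mulr_gt0 a0 a0))).
have -> : a * a * (b / a - 1) = a * b - a * a by field; lra.
by nra.
Qed.

End RealInequalities.

(** * Payoffs along unilateral deviations in a monotone game *)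

Section Game.
Variables (R : realType) (N n : nat) (owner : 'I_n -> 'I_N).
Variable v : 'I_N -> 'rV[R]_n -> R.
Implicit Types (i : 'I_N) (j l : 'I_n) (pi p q x s : 'rV[R]_n) (a t mu : R).

(* Keeping [g] abstract prevents unification from unfolding differentials. *)
Variable g : 'rV[R]_n -> 'I_n -> R.
Hypothesis g_grad : forall pi j, g pi j = grad_comp owner v pi j.

(** This is the A_j of the overview: the derivative of the owner's payoff towards the pure strategy
    [j], when [g] is the gradient. *)
Definition advantage pi j : R :=
  g pi j - \sum_(l | owner l == owner j) pi 0 l * g pi l.

Definition deviate pi j : 'rV[R]_n :=
  \row_l if owner l == owner j then (l == j)%:R else pi 0 l.

Lemma sum_owner (F : 'I_n -> R) :
  \sum_i \sum_(l | owner l == i) F l = \sum_l F l.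
Proof. by rewrite [RHS](partition_big owner xpredT). Qed.

Lemma deviate_unilateral pi j : in_X owner pi -> unilateral owner (owner j) pi (deviate pi j).
Proof.
move=> Xpi; split; first split.
- by move=> l lj; rewrite mxE lj eqxx ler0n.
- rewrite (bigD1 j)//= mxE !eqxx big1 ?addr0// => l /andP[/eqP lj /negbTE l'j].
  by rewrite mxE lj eqxx l'j.
- by move=> l /negbTE lj; rewrite mxE lj.
Qed.

Lemma in_X_unilateral i pi p : in_X owner pi -> unilateral owner i pi p -> in_X owner p.
Proof.
move=> Xpi [Xp pE] i'; have [->//|i'i] := eqVneq i' i.
have [pos sum1] := Xpi i'; split.
  by move=> l li; rewrite pE ?li//; exact: pos.
by rewrite -sum1; apply: eq_bigr => l /eqP li; rewrite pE ?li.
Qed.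

Lemma in_X_segment pi p (t : R) : in_X owner pi -> in_X owner p -> 0 <= t <= 1 ->
  in_X owner (pi + t *: (p - pi)).
Proof.
move=> Xpi Xp t01 i; have [pos sum1] := Xpi i; have [pos' sum1'] := Xp i.
split=> [l li|].
  by rewrite !mxE; have := pos _ li; have := pos' _ li; nra.
under eq_bigr do rewrite !mxE.
by rewrite big_split/= -mulr_sumr big_split/= sumrN sum1 sum1' subrr mulr0 addr0.
Qed.

Lemma unilateral_segment i pi p (t : R) : in_X owner pi -> unilateral owner i pi p -> 0 <= t <= 1 ->
  unilateral owner i pi (pi + t *: (p - pi)).
Proof.
move=> Xpi pip t01; split.
  exact: (in_X_segment Xpi (in_X_unilateral Xpi pip) t01 i).
by move=> l li; rewrite !mxE; have [_ ->//] := pip; rewrite subrr mulr0 addr0.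
Qed.

Lemma in_X_ge0 pi j : in_X owner pi -> 0 <= pi 0 j.
Proof. by move=> /(_ (owner j))[+ _]; apply. Qed.

Lemma in_X_le1 pi j : in_X owner pi -> pi 0 j <= 1.
Proof.
move=> Xpi; have [_ <-] := Xpi (owner j); rewrite (bigD1 j)//= lerDl.
by apply: sumr_ge0 => l _; exact: in_X_ge0.
Qed.

Lemma in_X_sum pi : in_X owner pi -> \sum_l pi 0 l = N%:R.
Proof.
move=> Xpi; rewrite -sum_owner (eq_bigr (fun=> 1)) ?sumr_const ?card_ord//.
by move=> i _; have [] := Xpi i.
Qed.

(** The subtracted average in [advantage] is common to the block, and the weights [p] give it total
    weight 1. *)
Lemma sum_advantage_block i pi p : \sum_(l | owner l == i) p 0 l = 1 ->
  \sum_(l | owner l == i) p 0 l * advantage pi l =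
  \sum_(l | owner l == i) g pi l * (p 0 l - pi 0 l).
Proof.
move=> p1; rewrite (eq_bigr (fun l => p 0 l * g pi l - p 0 l * (\sum_(l | owner l == i) pi 0 l * g pi l))).
  rewrite sumrB -mulr_suml p1 mul1r -sumrB.
  by apply: eq_bigr => l _; ring.
by move=> l /eqP li; rewrite /advantage li mulrBr.
Qed.

Lemma sum_advantage pi p : in_X owner p ->
  \sum_l p 0 l * advantage pi l = \sum_l g pi l * (p 0 l - pi 0 l).
Proof.
move=> Xp; rewrite -!sum_owner; apply: eq_bigr => i _.
by apply: sum_advantage_block; have [] := Xp i.
Qed.

Lemma advantage_deviate pi j :
  \sum_(l | owner l == owner j) g pi l * (deviate pi j 0 l - pi 0 l) = advantage pi j.
Proof.
rewrite -sum_advantage_block; last first.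
  rewrite (bigD1 j)//= mxE !eqxx big1 ?addr0// => l /andP[/eqP lj /negbTE l'j].
  by rewrite mxE lj eqxx l'j.
rewrite (bigD1 j)//= mxE !eqxx mul1r big1 ?addr0// => l /andP[/eqP lj /negbTE l'j].
by rewrite mxE lj eqxx l'j mul0r.
Qed.

Hypothesis diff_v : forall i pi, in_X owner pi -> differentiable (v i) pi.

Lemma diff_unilateral i pi p q : in_X owner q -> unilateral owner i pi p ->
  'd (v i) q (p - pi) = \sum_(l | owner l == i) g q l * (p 0 l - pi 0 l).
Proof.
move=> Xq [_ pE]; rewrite {1}(row_sum_delta (p - pi)) linear_sum/=.
rewrite (bigID (fun l => owner l == i))/= [X in _ + X]big1 ?addr0.
  by apply: eq_bigr => l /eqP li; rewrite linearZ/= !mxE g_grad /grad_comp li mulrC.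
by move=> l /pE pl; rewrite !mxE pl subrr scale0r linear0.
Qed.

Lemma unilateral_mvt i pi p : in_X owner pi -> unilateral owner i pi p ->
  exists2 t, 0 < t < 1 & v i p - v i pi =
    \sum_(l | owner l == i) g (pi + t *: (p - pi)) l * (p 0 l - pi 0 l).
Proof.
move=> Xpi pip; have Xp := in_X_unilateral Xpi pip.
pose h (t : R) : 'rV[R]_n := pi + t *: (p - pi).
have dvh (t : R) : 0 <= t <= 1 -> is_derive t 1 (v i \o h) ('d (v i) (h t) (p - pi)).
  move=> t01; have dt := diff_v i (in_X_segment Xpi Xp t01).
  have quotE : (fun e : R => e^-1 *: (((v i \o h) \o shift t) (e *: 1) - (v i \o h) t)) =
      (fun e : R => e^-1 *: ((v i \o shift (h t)) (e *: (p - pi)) - v i (h t))).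
    apply/funext => e /=; congr (_ *: (v i _ - _)).
    by rewrite /h /= [e%:A]mulr1 scalerDl addrCA.
  apply: DeriveDef; first by rewrite /derivable quotE; exact: (diff_derivable dt).
  by rewrite -deriveE// /derive quotE.
have [||t] := @MVT R (v i \o h) (fun t => 'd (v i) (h t) (p - pi)) 0 1 ltr01.
- by move=> t; rewrite in_itv/= => /andP[t0 t1]; apply: dvh; rewrite !ltW.
- apply: derivable_within_continuous => t; rewrite in_itv/= => t01.
  by have [] := dvh t t01.
rewrite in_itv/= => t01; rewrite /h/= scale1r scale0r addr0 subrKC subr0 mulr1 => ->.
exists t => //; rewrite diff_unilateral//; apply: in_X_segment => //.
by case/andP: t01 => *; rewrite !ltW.
Qed.

Hypothesis mono_v : monotone_game owner v.

Lemma monotone_sum pi p : in_X owner pi -> in_X owner p ->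
  \sum_l g p l * (p 0 l - pi 0 l) <= \sum_l g pi l * (p 0 l - pi 0 l).
Proof.
move=> Xpi Xp; rewrite -subr_le0 -sumrB.
have := mono_v Xp Xpi; rewrite sum_owner; congr (_ <= 0).
by apply: eq_bigr => l _; rewrite !g_grad mulrBl.
Qed.

Lemma sum_unilateral i pi p (F : 'I_n -> R) : unilateral owner i pi p ->
  \sum_l F l * (p 0 l - pi 0 l) = \sum_(l | owner l == i) F l * (p 0 l - pi 0 l).
Proof.
move=> [_ pE]; rewrite (bigID (fun l => owner l == i))/= [X in _ + X]big1 ?addr0//.
by move=> l /pE ->; rewrite subrr mulr0.
Qed.

Lemma sum_segment i pi p (t : R) (F : 'I_n -> R) : unilateral owner i pi p ->
  \sum_l F l * ((pi + t *: (p - pi)) 0 l - pi 0 l) =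
  t * \sum_(l | owner l == i) F l * (p 0 l - pi 0 l).
Proof.
move=> pip; rewrite -(sum_unilateral F pip) mulr_sumr.
by apply: eq_bigr => l _; rewrite !mxE; ring.
Qed.

(** Monotonicity, tested on two profiles that differ in one block, bounds the slope at the mean
    value point by the slope at [pi]: each payoff is concave in its own strategy. *)
Lemma unilateral_concave i pi p : in_X owner pi -> unilateral owner i pi p ->
  v i p - v i pi <= \sum_(l | owner l == i) g pi l * (p 0 l - pi 0 l).
Proof.
move=> Xpi pip; have [t /andP[t0 t1] ->] := unilateral_mvt Xpi pip.
have t01 : 0 <= t <= 1 by rewrite !ltW.
have := monotone_sum Xpi (in_X_segment Xpi (in_X_unilateral Xpi pip) t01).
by rewrite (sum_segment t (g _) pip) (sum_segment t (g pi) pip) ler_pM2l.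
Qed.

Lemma nash_of_advantage pi : in_X owner pi -> (forall j, advantage pi j <= 0) -> nash owner v pi.
Proof.
move=> Xpi adv; split=> // i p pip; rewrite -subr_le0.
apply: le_trans (unilateral_concave Xpi pip) _.
have [[pos p1] _] := pip; rewrite -sum_advantage_block//.
by apply: sumr_le0 => l /eqP li; rewrite mulr_ge0_le0// pos.
Qed.

(** * One-sided slopes and semicontinuity of the gain rates *)

Lemma unilateral_slope i pi p (c : R) : in_X owner pi -> unilateral owner i pi p ->
  c < \sum_(l | owner l == i) g pi l * (p 0 l - pi 0 l) ->
  \forall t \near 0^'+, c * t < v i (pi + t *: (p - pi)) - v i pi.
Proof.
move=> Xpi pip; rewrite -diff_unilateral// -deriveE; last exact: diff_v.
move=> cd; pose quot (t : R) := t^-1 *: ((v i \o shift pi) (t *: (p - pi)) - v i pi).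
have quot_cvg : quot t @[t --> 0^'] --> 'D_(p - pi) (v i) pi.
  exact: (diff_derivable (diff_v i Xpi)).
have slope : \forall t \near 0^'+, c < quot t.
  exact: (cvgr_gt _ (cvg_dnbhs_at_right quot_cvg) _ cd).
near=> t.
have t0 : 0 < t by near: t; exact: nbhs_right_gt.
have : c < quot t by near: t.
by rewrite mulrC -ltr_pdivlMl// /quot/= [X in v i X]addrC.
Unshelve. all: by end_near. Qed.

Lemma advantage_slope pi j (c : R) : in_X owner pi -> c < advantage pi j ->
  \forall t \near 0^'+, c * t < v (owner j) (pi + t *: (deviate pi j - pi)) - v (owner j) pi.
Proof.
move=> Xpi cadv; apply: unilateral_slope => //; first exact: deviate_unilateral.
by rewrite advantage_deviate.
Qed.

Lemma payoff_continuous i x (e : R) : in_X owner x -> 0 < e ->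
  exists2 r, 0 < r & forall p, (forall l, `|p 0 l - x 0 l| < r) -> `|v i p - v i x| < e.
Proof.
move=> Xx e0; have := differentiable_continuous (diff_v i Xx).
move=> /cvgrPdist_lt/(_ e e0)/nbhs_ballP[r/= r0 H]; exists r => // p px.
rewrite distrC; apply: H; split=> // i' l; rewrite ord1 /ball/= distrC; exact: px.
Qed.

(** By concavity the gain rate dominates every difference quotient. For a fixed step [t] the
    quotient depends on payoff values alone, hence varies continuously; this replaces continuity of
    the gradient. *)
Lemma advantage_lsc x j (c : R) : in_X owner x -> c < advantage x j ->
  exists2 r, 0 < r & forall pi, in_X owner pi -> (forall l, `|pi 0 l - x 0 l| < r) ->
    c < advantage pi j.
Proof.
move=> Xx cadv; pose c' := (c + advantage x j) / 2.
have [cc' c'adv] : c < c' /\ c' < advantage x j by rewrite /c'; split; lra.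
pose y pi (t : R) : 'rV[R]_n := pi + t *: (deviate pi j - pi).
have slopes := advantage_slope Xx c'adv.
near (0 : R)^'+ => t.
have t0 : 0 < t by near: t; exact: nbhs_right_gt.
have t1 : t <= 1 by near: t; exact: nbhs_right_le.
have slope : c' * t < v (owner j) (y x t) - v (owner j) x by near: t.
have t01 : 0 <= t <= 1 by rewrite t1 ltW.
(* Two payoff values are perturbed, so each may use half of the slack. *)
pose e := (c' - c) * t / 2; have e0 : 0 < e by rewrite divr_gt0// mulr_gt0// subr_gt0.
have [r r0 vx] := payoff_continuous (owner j) Xx e0.
have Xy : in_X owner (y x t).
  by apply: in_X_segment => //; apply: in_X_unilateral Xx (deviate_unilateral _ Xx).
have [r' r'0 vy] := payoff_continuous (owner j) Xy e0.
exists (Num.min r r'); first by rewrite lt_min r0.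
move=> pi Xpi pix; rewrite -(ltr_pM2l t0).
have uni := unilateral_segment Xpi (deviate_unilateral j Xpi) t01.
have := unilateral_concave Xpi uni; rewrite -/(y pi t).
have -> : \sum_(l | owner l == owner j) g pi l * (y pi t 0 l - pi 0 l) = t * advantage pi j.
  rewrite -advantage_deviate mulr_sumr; apply: eq_bigr => l _.
  by rewrite !mxE; ring.
apply: lt_le_trans.
have yle l : `|y pi t 0 l - y x t 0 l| < r'.
  apply: (@le_lt_trans _ _ `|pi 0 l - x 0 l|); last first.
    by have := pix l; rewrite lt_min => /andP[].
  rewrite !mxE; case: ifP => _; last by rewrite !subrr !mulr0 !addr0.
  set b := _%:R.
  have -> : pi 0 l + t * (b - pi 0 l) - (x 0 l + t * (b - x 0 l)) = (1 - t) * (pi 0 l - x 0 l) by ring.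
  by rewrite normrM ger0_norm ?subr_ge0// ler_piMl//; lra.
have xle l : `|pi 0 l - x 0 l| < r by have := pix l; rewrite lt_min => /andP[].
have := vx _ xle; have := vy _ yle; rewrite !ltr_norml => /andP[+ _] /andP[_].
have -> : t * c = c' * t - 2 * e by rewrite /e; field.
lra.
Unshelve. all: by end_near. Qed.

(** * First-order optimality conditions for the three divergences *)

Lemma segment_deviate_same p j (t : R) :
  (p + t *: (deviate p j - p)) 0 j = (1 - t) * p 0 j + t.
Proof. by rewrite !mxE !eqxx mulr1n; ring. Qed.

Lemma segment_deviate_other p j l (t : R) : owner l = owner j -> l != j ->
  (p + t *: (deviate p j - p)) 0 l = (1 - t) * p 0 l.
Proof. by move=> lj /negbTE l'j; rewrite !mxE lj eqxx l'j mulr0n; ring. Qed.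

Lemma in_X_deviate p j (t : R) : in_X owner p -> 0 <= t <= 1 ->
  in_X owner (p + t *: (deviate p j - p)).
Proof.
by move=> Xp; apply: in_X_segment => //; apply: in_X_unilateral Xp (deviate_unilateral j Xp).
Qed.

(** The first-order condition shared by all three divergences: the conclusion compares one-sided
    derivatives at t = 0, the logarithmic cost having the right-hand side as its derivative. *)
Lemma advantage_le_log_weights j p (w : 'I_n -> R) (c : R) :
  in_X owner p -> (forall l, 0 < p 0 l) -> 0 <= c -> (forall l, 0 <= w l) ->
  (forall t, 0 < t < 1 ->
    v (owner j) (p + t *: (deviate p j - p)) - v (owner j) p <=
    - (c * \sum_(l | owner l == owner j) w l * ln ((p + t *: (deviate p j - p)) 0 l / p 0 l))) ->
  advantage p j <= c * (\sum_(l | owner l == owner j) w l - w j / p 0 j).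
Proof.
move=> Xp p0 c0 w0 opt; rewrite leNgt; apply/negP.
set B := c * _ => Badv; pose d := (B + advantage p j) / 2.
have [Bd dadv] : B < d /\ d < advantage p j by rewrite /d; split; lra.
pose W := \sum_(l | (owner l == owner j) && (l != j)) w l.
(* Bounding every logarithm below by ln x >= 1 - 1/x and dividing by [t] yields [F], whose limit at
   0 is [B]. *)
pose F t := c * (W / (1 - t) - w j * (1 - p 0 j) / ((1 - t) * p 0 j + t)).
have F_cvg : F t @[t --> (0 : R)^'+] --> B.
  have -> : B = F 0.
    rewrite /B /F (bigD1 j)//= -/W !subr0 !mul1r addr0; field.
    by rewrite gt_eqF.
  apply: cvg_at_right_filter; rewrite /F.
  have id_cvg : t @[t --> (0 : R)] --> (0 : R) by exact: cvg_id.
  apply: cvgM; first exact: cvg_cst.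
  apply: cvgB; (apply: cvgM; first exact: cvg_cst); apply: cvgV.
  - by rewrite subr0 oner_eq0.
  - by apply: cvgB => //; exact: cvg_cst.
  - by rewrite subr0 mul1r addr0 gt_eqF.
  - apply: cvgD => //; apply: cvgM; last exact: cvg_cst.
    by apply: cvgB => //; exact: cvg_cst.
have slopes := advantage_slope Xp dadv.
have Fd : \forall t \near 0^'+, F t < d by exact: (cvgr_lt _ F_cvg _ Bd).
near (0 : R)^'+ => t.
have t0 : 0 < t by near: t; exact: nbhs_right_gt.
have t1 : t < 1 by near: t; exact: nbhs_right_lt.
have slope : d * t < v (owner j) (p + t *: (deviate p j - p)) - v (owner j) p by near: t.
have Ft : F t < d by near: t.
have t01 : 0 < t < 1 by rewrite t0.
suff : - (c * \sum_(l | owner l == owner j) w l * ln ((p + t *: (deviate p j - p)) 0 l / p 0 l)) <= t * F t.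
  move=> /(le_trans (opt _ t01))/(lt_le_trans slope).
  by rewrite mulrC ltr_pM2l// ltNge (ltW Ft).
rewrite /F mulrCA -mulrN ler_wpM2l// (bigD1 j)//= opprD mulrBr addrC lerD//.
  rewrite -sumrN /W !mulr_suml mulr_sumr; apply: ler_sum => l /andP[/eqP lj l'j].
  rewrite segment_deviate_other// mulfK ?gt_eqF// -mulrN [leRHS]mulrCA ler_wpM2l//.
  have := @ln_ge_1subV R (1 - t); rewrite subr_gt0 => /(_ t1).
  have -> : 1 - (1 - t)^-1 = - (t / (1 - t)) by field; lra.
  lra.
rewrite segment_deviate_same -!mulrA [leRHS](_ : _ = - (w j * (t * ((1 - p 0 j) / ((1 - t) * p 0 j + t))))).
  rewrite lerN2 ler_wpM2l//.
  have q0 : 0 < (1 - t) * p 0 j + t by have := p0 j; nra.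
  have := @ln_ge_1subV R (((1 - t) * p 0 j + t) / p 0 j); rewrite divr_gt0// => /(_ isT).
  apply: le_trans; rewrite le_eqVlt; apply/orP; left; apply/eqP.
  by field; rewrite !gt_eqF.
by ring.
Unshelve. all: by end_near. Qed.

(** The other coordinates scale by (1 - t)^a >= 1 - t, while coordinate [j] rises from 0 to [t]. *)
Lemma hellsum_ge_boundary a j p s (t : R) : 0 < a < 1 -> in_X owner p -> p 0 j = 0 ->
  0 <= t <= 1 ->
  (1 - t) * hellsum owner a (owner j) p s + t `^ a * s 0 j `^ (1 - a) <=
  hellsum owner a (owner j) (p + t *: (deviate p j - p)) s.
Proof.
move=> /andP[a0 a1] Xp pj0 /andP[t0 t1].
rewrite /hellsum (bigD1 j)//= [leRHS](bigD1 j)//= segment_deviate_same pj0 mulr0 add0r.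
rewrite powR0 ?gt_eqF// mul0r add0r [leLHS]addrC lerD2l mulr_sumr.
apply: ler_sum => l /andP[/eqP lj l'j]; rewrite segment_deviate_other//.
rewrite powRM ?subr_ge0 ?in_X_ge0// mulrA ler_wpM2r ?powR_ge0// ler_wpM2r ?powR_ge0//.
have [->|t'1] := eqVneq t 1; first by rewrite subrr powR_ge0.
by apply: ger1_powR; [rewrite subr_gt0 lt_neqAle t'1 t1/=; lra|exact: ltW].
Qed.

Lemma hellsum_gt0 a i p s : 0 < a < 1 -> in_X owner p -> (forall l, 0 < s 0 l) ->
  0 < hellsum owner a i p s.
Proof.
move=> /andP[a0 a1] Xp s0.
have term_ge0 l : owner l == i -> 0 <= p 0 l `^ a * s 0 l `^ (1 - a).
  by move=> _; rewrite mulr_ge0// powR_ge0.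
rewrite lt_neqAle sumr_ge0// andbT; apply/eqP => /esym sum0.
have term0 := psumr_eq0P term_ge0 sum0; have [_ /esym/eqP] := Xp i.
rewrite big1 ?oner_eq0// => l li; have /eqP := term0 l li.
rewrite mulf_eq0 powR_eq0 (gt_eqF a0) andbT => /orP[/eqP//|].
by rewrite gt_eqF// powR_gt0.
Qed.

Lemma powR_mean_ratio a (x y : R) : 0 < a -> 0 < x -> 0 < y ->
  x `^ a * y `^ (1 - a) = x * (y / x) `^ (1 - a).
Proof.
move=> a0 x0 y0; rewrite powRM ?invr_ge0 ?ltW// mulrCA [RHS]mulrC; congr (_ * _).
by rewrite -(powR_inv1 (ltW x0)) -powRrM mulN1r opprB mulr_powRB1// ltW.
Qed.

Lemma powR_mean_le a (x y : R) : 0 < a < 1 -> 0 <= x -> 0 < y ->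
  x `^ a * y `^ (1 - a) <= a * x + (1 - a) * y.
Proof.
move=> /andP[a0 a1]; rewrite le_eqVlt => /predU1P[<- y0|x0 y0].
  by rewrite powR0 ?gt_eqF// mul0r mulr0 add0r mulr_ge0; lra.
rewrite powR_mean_ratio//.
have := @powR_le_tangent1 _ (y / x) (1 - a); rewrite divr_gt0// => /(_ isT) tangent.
apply: le_trans (ler_wpM2l (ltW x0) (tangent _)) _; first lra.
rewrite le_eqVlt; apply/orP; left; apply/eqP; field; lra.
Qed.

Lemma hellsum_le1 a i p s : 0 < a < 1 -> in_X owner p -> in_interior_X owner s ->
  hellsum owner a i p s <= 1.
Proof.
move=> a01 Xp [Xs s0]; have [_ p1] := Xp i; have [_ s1] := Xs i.
apply: (@le_trans _ _ (\sum_(l | owner l == i) (a * p 0 l + (1 - a) * s 0 l))).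
  by apply: ler_sum => l _; apply: powR_mean_le => //; exact: in_X_ge0.
by rewrite big_split/= -!mulr_sumr p1 s1; lra.
Qed.

Lemma xlogxy_pos (x y : R) : 0 < x -> 0 < y -> xlogxy x y = (x * ln (x / y))%:E.
Proof. by move=> x0 y0; rewrite /xlogxy gt_eqF// y0. Qed.

Lemma deviate_gt0 p j (t : R) : (forall l, 0 < p 0 l) -> 0 <= t < 1 ->
  forall l, 0 < (p + t *: (deviate p j - p)) 0 l.
Proof.
move=> p0 /andP[t0 t1] l; have -> : (p + t *: (deviate p j - p)) 0 l =
  (1 - t) * p 0 l + t * deviate p j 0 l by rewrite !mxE; ring.
rewrite ltr_pwDl//; first by rewrite mulr_gt0// subr_gt0.
by rewrite mulr_ge0// mxE; case: ifP => // _; exact: ltW.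
Qed.

Lemma reverseKL_eq_gt0 mu s p : 0 < mu -> in_interior_X owner s ->
  perturbed_eq owner v (ReverseKL R) mu s p -> forall l, 0 < p 0 l.
Proof.
move=> mu0 [Xs s0] [Xp opt] j; rewrite lt_neqAle (in_X_ge0 j Xp) andbT.
apply/eqP => /esym pj0.
(* Copying the block of [s] gives a finite objective, whereas a zero coordinate of [p] makes the
   divergence [+oo] and the objective [-oo]. *)
pose q : 'rV[R]_n := \row_l if owner l == owner j then s 0 l else p 0 l.
have uq : unilateral owner (owner j) p q.
  have [pos s1] := Xs (owner j); split; first split.
  - by move=> l lj; rewrite mxE lj eqxx ltW.
  - by rewrite -s1; apply: eq_bigr => l lj; rewrite mxE lj.
  - by move=> l /negbTE lj; rewrite mxE lj.
have := opt _ _ uq; rewrite /pert_obj/=.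
have -> : (\sum_(l | owner l == owner j) xlogxy (s ord0 l) (p ord0 l) = +oo)%E.
  apply/esum_eqyP.
    move=> l _; rewrite /xlogxy; case: ifP => // _; case: ifP => //.
  by exists j; split => //; rewrite ?mem_index_enum// /xlogxy gt_eqF// pj0 ltxx.
rewrite (eq_bigr (fun l => (s 0 l * ln (s 0 l / q 0 l))%:E)); last first.
  by move=> l lj; rewrite xlogxy_pos// mxE lj.
by rewrite sumEFin gt0_muley ?lte_fin//= -EFinM -EFinB leeNy_eq.
Qed.

Lemma reverseKL_advantage_le mu s p : 0 < mu -> in_interior_X owner s ->
  perturbed_eq owner v (ReverseKL R) mu s p ->
  forall j, advantage p j <= mu * (1 - s 0 j / p 0 j).
Proof.
move=> mu0 Is eq_p j; have p0 := reverseKL_eq_gt0 mu0 Is eq_p.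
have [[Xs s0] [Xp opt]] := (Is, eq_p); have [_ <-] := Xs (owner j).
(* The reverse KL cost is already logarithmic, with weights [s] of total mass 1. *)
apply: (@advantage_le_log_weights _ _ (fun l => s 0 l)) => //; [exact: ltW|by move=> l; exact: ltW|].
move=> t /andP[t0 t1]; have t01 : 0 <= t <= 1 by rewrite !ltW.
have q0 : forall l, 0 < (p + t *: (deviate p j - p)) 0 l.
  by apply: deviate_gt0 => //; rewrite ltW.
have := opt _ _ (unilateral_segment Xp (deviate_unilateral j Xp) t01).
move: (p + t *: _) q0 => q q0; rewrite /pert_obj/=.
have GE y : (forall l, 0 < y 0 l) -> (\sum_(l | owner l == owner j) xlogxy (s ord0 l) (y ord0 l) =
    (\sum_(l | owner l == owner j) s 0 l * (ln (s 0 l) - ln (y 0 l)))%:E)%E.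
  move=> y0; rewrite -sumEFin; apply: eq_bigr => l _.
  by rewrite xlogxy_pos// ln_div ?posrE.
rewrite !GE// -!EFinM -!EFinB lee_fin.
have -> : \sum_(l | owner l == owner j) s 0 l * ln (q 0 l / p 0 l) =
   \sum_(l | owner l == owner j) s 0 l * (ln (s 0 l) - ln (p 0 l)) -
   \sum_(l | owner l == owner j) s 0 l * (ln (s 0 l) - ln (q 0 l)).
  by rewrite -sumrB; apply: eq_bigr => l _; rewrite ln_div ?posrE//; ring.
rewrite mulrBr; lra.
Qed.

(* At a vertex-ward deviation from a face, [hellsum] grows like [t `^ a], faster than any payoff loss. *)
Lemma hellsum_opt_gt0 a (c : R) s p j : 0 < a < 1 -> 0 < c -> in_interior_X owner s -> in_X owner p ->
  (forall t, 0 < t < 1 ->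
    let q := p + t *: (deviate p j - p) in
    hellsum owner a (owner j) p s <= hellsum owner a (owner j) q s ->
    v (owner j) q - v (owner j) p <=
      - (c * (hellsum owner a (owner j) q s - hellsum owner a (owner j) p s))) ->
  0 < p 0 j.
Proof.
move=> a01 c0 [Xs s0] Xp opt; rewrite lt_neqAle (in_X_ge0 j Xp) andbT.
apply/eqP => /esym pj0; set H := hellsum _ _ _ p s in opt.
have /andP[a0 a1] := a01.
have H0 : 0 < H by exact: hellsum_gt0.
pose d := advantage p j - 1.
have dadv : d < advantage p j by rewrite /d; lra.
have slopes := advantage_slope Xp dadv.
pose w := s 0 j `^ (1 - a); have w0 : 0 < w by rewrite powR_gt0.
(* Once [t]^ (a - 1)[exceeds]M[, the gain]t [^ a * w] outweighs both the loss [t * H] in the other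
   coordinates and the payoff loss, at most [t * |d|]. The bound [t < r] ensures this. *)
pose M := (H + `|d| / c) / w.
have M0 : 0 < M.
  by rewrite divr_gt0// ltr_pwDl// divr_ge0// ltW.
pose r := M `^ ((a - 1)^-1).
have r0 : 0 < r by rewrite powR_gt0.
near (0 : R)^'+ => t.
have t0 : 0 < t by near: t; exact: nbhs_right_gt.
have t1 : t < 1 by near: t; exact: nbhs_right_lt.
have tr : t < r by near: t; exact: nbhs_right_lt.
have slope : d * t < v (owner j) (p + t *: (deviate p j - p)) - v (owner j) p by near: t.
have t01 : 0 < t < 1 by rewrite t0.
have tM : M < t `^ (a - 1).
  have -> : M = r `^ (a - 1).
    by rewrite -powRrM mulVf ?powRr1 ?(ltW M0)//; rewrite lt_eqF//; lra.
  have -> : a - 1 = - (1 - a) by ring.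
  rewrite !powRN ltf_pV2 ?posrE ?powR_gt0//.
  by apply: gt0_ltr_powR; rewrite ?nnegrE ?ltW//; lra.
have ta : t `^ a = t * t `^ (a - 1).
  by rewrite -{2}(powRr1 (ltW t0)) -powRD ?(gt_eqF t0) ?implybT//; congr (_ `^ _); ring.
have t01' : 0 <= t <= 1 by rewrite !ltW.
have Hq := @hellsum_ge_boundary a j p s t a01 Xp pj0 t01'.
have := opt t t01 => /=; rewrite -/H; rewrite -/H -/w ta in Hq.
set Hq' := hellsum _ _ _ _ s in Hq *.
have Mw : M * w = H + `|d| / c by rewrite /M mulfVK// gt_eqF.
have tMw : t * (H + `|d| / c) < t * t `^ (a - 1) * w.
  by rewrite -Mw -mulrA ltr_pM2l// ltr_pM2r.
have gain : t * (`|d| / c) < Hq' - H.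
  by move: Hq tMw; rewrite mulrDr; lra.
have nd : 0 <= t * (`|d| / c) by rewrite mulr_ge0 ?(ltW t0)// divr_ge0// ltW.
move=> /(_ _) opt'; have {}opt' := opt' ltac:(lra).
have : c * (t * (`|d| / c)) < c * (Hq' - H) by rewrite ltr_pM2l.
have -> : c * (t * (`|d| / c)) = t * `|d| by field; rewrite gt_eqF.
have : - (t * `|d|) <= d * t.
  by rewrite mulrC -mulNr ler_wpM2r ?(ltW t0)// lerNl; have := ler_norm (- d); rewrite normrN.
lra.
Unshelve. all: by end_near. Qed.

(** Written as exponentials of log-ratios, the sum can be bounded below by tangents of [expR], which
    produces the cost required by [advantage_le_log_weights]. *)
Lemma hellsum_weights a p s (q : 'rV[R]_n) i : 0 < a < 1 -> (forall l, 0 < p 0 l) ->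
  (forall l, 0 < q 0 l) ->
  hellsum owner a i q s =
  \sum_(l | owner l == i) p 0 l `^ a * s 0 l `^ (1 - a) * expR (a * ln (q 0 l / p 0 l)).
Proof.
move=> /andP[a0 a1] p0 q0; apply: eq_bigr => l _.
have -> : expR (a * ln (q 0 l / p 0 l)) = (q 0 l / p 0 l) `^ a.
  by rewrite /powR gt_eqF// divr_gt0.
by rewrite mulrAC -powRM ?ltW// ?divr_gt0// mulrCA divff ?gt_eqF// mulr1.
Qed.

Lemma sum_expR_ge i (w y : 'I_n -> R) : (forall l, 0 <= w l) ->
  \sum_(l | owner l == i) w l + \sum_(l | owner l == i) w l * y l <=
  \sum_(l | owner l == i) w l * expR (y l).
Proof.
move=> w0; rewrite -big_split/=; apply: ler_sum => l _.
by rewrite -[X in X + _](mulr1 (w l)) -mulrDr ler_wpM2l// expR_ge1Dx.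
Qed.

(* Jensen's inequality for [ln], by tangents of [expR] at the weighted mean of [y]. *)
Lemma ln_sum_expR_ge i (w y : 'I_n -> R) : (forall l, 0 <= w l) ->
  let W := \sum_(l | owner l == i) w l in 0 < W ->
  (\sum_(l | owner l == i) w l * y l) / W <=
  ln (\sum_(l | owner l == i) w l * expR (y l)) - ln W.
Proof.
move=> w0 W W0; set m := (\sum_(l | _) w l * y l) / W.
have sumE : \sum_(l | owner l == i) w l * expR (y l) =
    expR m * \sum_(l | owner l == i) w l * expR (y l - m).
  rewrite mulr_sumr; apply: eq_bigr => l _; rewrite mulrCA -expRD.
  by congr (_ * expR _); ring.
have WE : W <= \sum_(l | owner l == i) w l * expR (y l - m).
  apply: le_trans (sum_expR_ge _ _ w0); rewrite -/W.
  rewrite (eq_bigr (fun l => w l * y l - w l * m)); last by move=> l _; rewrite mulrBr.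
  by rewrite sumrB -mulr_suml -/W /m mulrC divfK ?gt_eqF// subrr addr0.
have E0 : 0 < \sum_(l | owner l == i) w l * expR (y l - m) by exact: lt_le_trans WE.
rewrite sumE lnM ?posrE ?expR_gt0// expRK -addrA lerDl subr_ge0.
by rewrite ler_ln ?posrE.
Qed.

Lemma hellsum_ratio a p s j : 0 < a -> 0 < p 0 j -> 0 < s 0 j ->
  p 0 j `^ a * s 0 j `^ (1 - a) / p 0 j = (s 0 j / p 0 j) `^ (1 - a).
Proof. by move=> a0 p0 s0; rewrite powR_mean_ratio// mulrC mulKf// gt_eqF. Qed.

(** The weights are the terms of [hellsum] at [p]: the tangent bound expR y >= 1 + y linearises the
    cost in the log-ratios, and [hellsum_le1] replaces the total weight by 1. *)
Lemma alpha_advantage_le a mu s p : 0 < a < 1 -> 0 < mu -> in_interior_X owner s ->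
  perturbed_eq owner v (AlphaDiv a) mu s p ->
  (forall l, 0 < p 0 l) /\
  forall j, advantage p j <= mu / (1 - a) * (1 - (s 0 j / p 0 j) `^ (1 - a)).
Proof.
move=> a01 mu0 Is [Xp opt]; have [Xs s0] := Is; have /andP[a0 a1] := a01.
have a1' : 0 < 1 - a by rewrite subr_gt0.
pose c := mu / (a * (1 - a)).
have c0 : 0 < c by rewrite divr_gt0// mulr_gt0.
have gainE j t q : q = p + t *: (deviate p j - p) -> 0 < t < 1 ->
    v (owner j) q - v (owner j) p <=
      - (c * (hellsum owner a (owner j) q s - hellsum owner a (owner j) p s)).
  move=> qE /andP[t0 t1]; have t01 : 0 <= t <= 1 by rewrite !ltW.
  have := opt _ _ (unilateral_segment Xp (deviate_unilateral j Xp) t01).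
  rewrite /pert_obj/= -?EFinM -?EFinB lee_fin -qE.
  have muE h : mu * ((1 - h) / (a * (1 - a))) = c * (1 - h) by rewrite /c; ring.
  rewrite !muE; lra.
have p0 l : 0 < p 0 l by apply: (hellsum_opt_gt0 a01 c0 Is Xp) => t t01 q _; exact: gainE erefl t01.
split=> // j.
pose w l := p 0 l `^ a * s 0 l `^ (1 - a).
have w0 l : 0 <= w l by rewrite mulr_ge0 ?powR_ge0.
have ca : c * a = mu / (1 - a) by rewrite /c; field; lra.
have : advantage p j <= (c * a) * (\sum_(l | owner l == owner j) w l - w j / p 0 j).
  apply: advantage_le_log_weights => //; first by rewrite mulr_ge0// ltW.
  move=> t t01; apply: le_trans (gainE j t _ erefl t01) _; rewrite lerN2 -mulrA ler_pM2l//.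
  have q0 : forall l, 0 < (p + t *: (deviate p j - p)) 0 l.
    by apply: deviate_gt0 => //; case/andP: t01 => t0 ->; rewrite ltW.
  rewrite (hellsum_weights s _ a01 p0 q0) mulr_sumr.
  have := sum_expR_ge (owner j) (fun l => a * ln ((p + t *: (deviate p j - p)) 0 l / p 0 l)) w0.
  rewrite -/(hellsum owner a (owner j) p s) addrC -lerBrDr; apply: le_trans.
  by apply: ler_sum => l _; rewrite mulrCA.
rewrite ca /w hellsum_ratio// => /le_trans; apply.
rewrite ler_wpM2l ?divr_ge0 ?(ltW mu0) ?(ltW a1')// lerD2r; exact: hellsum_le1.
Qed.

Lemma renyi_advantage_le a mu s p : 0 < a < 1 -> 0 < mu -> in_interior_X owner s ->
  perturbed_eq owner v (RenyiDiv a) mu s p ->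
  (forall l, 0 < p 0 l) /\
  forall j, advantage p j <= mu * a / (1 - a) * (1 - (s 0 j / p 0 j) `^ (1 - a)).
Proof.
move=> a01 mu0 Is [Xp opt]; have [Xs s0] := Is; have /andP[a0 a1] := a01.
have a1' : 0 < 1 - a by rewrite subr_gt0.
pose c := mu / (1 - a).
have c0 : 0 < c by rewrite divr_gt0.
have gainE j t q : q = p + t *: (deviate p j - p) -> 0 < t < 1 ->
    v (owner j) q - v (owner j) p <=
      - (c * (ln (hellsum owner a (owner j) q s) - ln (hellsum owner a (owner j) p s))).
  move=> qE /andP[t0 t1]; have t01 : 0 <= t <= 1 by rewrite !ltW.
  have Xq : in_X owner q by rewrite qE; exact: in_X_deviate.
  have := opt _ _ (unilateral_segment Xp (deviate_unilateral j Xp) t01).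
  rewrite /pert_obj/= -qE !hellsum_gt0// -?EFinM -?EFinB lee_fin.
  have muE h : mu * (h / (a - 1)) = - (c * h) by rewrite /c; field; lra.
  rewrite !muE; lra.
have p0 l : 0 < p 0 l.
  apply: (hellsum_opt_gt0 a01 c0 Is Xp) => t t01 q Hle; apply: le_trans (gainE _ _ _ erefl t01) _.
  have Xq : in_X owner q by apply: in_X_deviate => //; case/andP: t01 => *; rewrite !ltW.
  rewrite -/q lerN2 ler_pM2l//.
  have := hellsum_le1 (owner l) a01 Xq Is.
  have := hellsum_gt0 (owner l) a01 Xq s0; have := hellsum_gt0 (owner l) a01 Xp s0.
  move: (hellsum _ _ _ q s) (hellsum _ _ _ p s) Hle => Hq Hp Hle Hp0 Hq0 Hq1.
  (* As Hp <= Hq <= 1, the logarithmic increase is at least (Hq - Hp) / Hq >= Hq - Hp, the form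
     [hellsum_opt_gt0] asks for. *)
  rewrite -ln_div ?posrE//; have := @ln_ge_1subV R (Hq / Hp); rewrite divr_gt0// => /(_ isT).
  apply: le_trans; rewrite invf_div.
  have -> : 1 - Hp / Hq = (Hq - Hp) / Hq by field; lra.
  by rewrite ler_pdivlMr// ler_piMr// subr_ge0.
split=> // j.
pose w l := p 0 l `^ a * s 0 l `^ (1 - a).
have w0 l : 0 <= w l by rewrite mulr_ge0 ?powR_ge0.
pose H := \sum_(l | owner l == owner j) w l.
have H0 : 0 < H by exact: hellsum_gt0.
have H1 : H <= 1 by exact: hellsum_le1.
have cH : 0 <= c * a / H by apply: divr_ge0; [apply: mulr_ge0|]; exact: ltW.
(* Jensen's inequality normalises the weights by their sum [H]; since H <= 1, the factor 1/H can
   afterwards be dropped from the subtracted ratio. *)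
have : advantage p j <= (c * a / H) * (H - w j / p 0 j).
  apply: advantage_le_log_weights => //.
  move=> t t01; apply: le_trans (gainE j t _ erefl t01) _; rewrite lerN2 -!mulrA !ler_pM2l ?invr_gt0//.
  have q0 : forall l, 0 < (p + t *: (deviate p j - p)) 0 l.
    by apply: deviate_gt0 => //; case/andP: t01 => t0 ->; rewrite ltW.
  rewrite (hellsum_weights s _ a01 p0 q0).
  have := @ln_sum_expR_ge (owner j) w (fun l => a * ln ((p + t *: (deviate p j - p)) 0 l / p 0 l)) w0.
  rewrite -/H => /(_ H0); apply: le_trans.
  rewrite mulrCA [leLHS]mulrC ler_wpM2r ?invr_ge0 ?(ltW H0)// mulr_sumr.
  by apply: ler_sum => l _; rewrite mulrCA.
rewrite /w hellsum_ratio// => /le_trans; apply.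
have -> : mu * a / (1 - a) = c * a by rewrite /c; ring.
set r := _ `^ _; have r0 : 0 <= r by exact: powR_ge0.
have ca0 : 0 <= c * a by apply: mulr_ge0; exact: ltW.
rewrite -(mulrA (c * a)) (ler_wpM2l ca0)//.
have -> : H^-1 * (H - r) = 1 - r / H by field; lra.
by rewrite lerD2l lerN2 ler_pdivlMr// ler_piMr.
Qed.

(** The exponent [b] is 1 for reverse KL and 1 - a otherwise. Both constants are chosen before [s]
    and [p], so they serve all iterations. *)
Lemma perturbed_eq_advantage (D : divergence R) mu : alpha_ok D -> 0 < mu ->
  exists2 c, 0 < c & exists2 b, 0 < b & forall s p,
    in_interior_X owner s -> perturbed_eq owner v D mu s p ->
    in_interior_X owner p /\
    forall j, advantage p j <= c * (1 - (s 0 j / p 0 j) `^ b).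
Proof.
case: D => [a|a|] /= a01 mu0; last first.
  exists mu => //; exists 1 => // s p Is eq_p; have p0 := reverseKL_eq_gt0 mu0 Is eq_p.
  split=> [|j]; first by split=> //; case: eq_p.
  rewrite powRr1; first exact: reverseKL_advantage_le.
  by rewrite divr_ge0 ?ltW//; have [_] := Is.
all: have /andP[a0 a1] := a01.
  exists (mu * a / (1 - a)); first by rewrite divr_gt0 ?mulr_gt0 ?subr_gt0.
  exists (1 - a); first by rewrite subr_gt0.
  move=> s p Is eq_p; have [p0 adv] := renyi_advantage_le a01 mu0 Is eq_p.
  by split=> //; split=> //; case: eq_p.
exists (mu / (1 - a)); first by rewrite divr_gt0 ?subr_gt0.
exists (1 - a); first by rewrite subr_gt0.
move=> s p Is eq_p; have [p0 adv] := alpha_advantage_le a01 mu0 Is eq_p.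
by split=> //; split=> //; case: eq_p.
Qed.

End Game.

(** * Limits in the strategy space along ultrafilters *)

Section LimitsInSimplex.
Variables (R : realType) (N n : nat) (owner : 'I_n -> 'I_N).

Lemma ultra_fmap T S (f : T -> S) (U : set_system T) :
  UltraFilter U -> UltraFilter (f @ U).
Proof.
move=> FU; split=> [|G GF fUG]; first exact: fmap_proper_filter.
rewrite eqEsubset; split=> // B GB.
have [//|UnB] := in_ultra_setVsetC (f @^-1` B) FU.
have : G (~` B) by apply: fUG.
by move=> /(filterI GB); rewrite setICr => /filter_not_empty.
Qed.

Lemma cvg_sum_fin T (U : set_system T) (I : finType) (P : pred I)
    (f : I -> T -> R) (a : I -> R) : Filter U ->
  (forall i, P i -> f i x @[x --> U] --> a i) ->
  \sum_(i | P i) f i x @[x --> U] --> \sum_(i | P i) a i.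
Proof. by move=> FU fa; apply: cvg_big => //; exact: add_continuous. Qed.

(** An ultrafilter replaces the extraction of subsequences: by compactness of [0, 1] all coordinates
    converge along it at once. *)
Lemma ultra_simplex_lim (U : set_system nat) (s_ : nat -> 'rV[R]_n) :
  UltraFilter U -> (forall k, in_X owner (s_ k)) ->
  exists2 x, in_X owner x & forall j, s_ k 0 j @[k --> U] --> (x 0 j : R).
Proof.
move=> FU Xs.
have lims j : exists l : R, s_ k 0 j @[k --> U] --> l.
  have := @segment_compact R 0 1; rewrite compact_ultra.
  move=> /(_ (s_ k 0 j @[k --> U]) (ultra_fmap _ FU)) [|l [_ sl]]; last by exists l.
  by apply: (@filterE _ U) => k /=; rewrite in_itv/= (in_X_ge0 j (Xs k)) (in_X_le1 j (Xs k)).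
pose x : 'rV[R]_n := \row_j xget 0 [set l : R | s_ k 0 j @[k --> U] --> l].
have sx j : s_ k 0 j @[k --> U] --> (x 0 j : R).
  by rewrite mxE; have [l sl] := lims j; case: xgetP => [y -> //|/(_ l)].
exists x => // i; split=> [j ji|].
  by apply: (cvgr_to_ge (sx j)); apply: filterE => k; exact: (in_X_ge0 j (Xs k)).
have sum_cvg : \sum_(j | owner j == i) s_ k 0 j @[k --> U] --> \sum_(j | owner j == i) x 0 j.
  by apply: cvg_sum_fin => j _; exact: sx.
have sum1 : \sum_(j | owner j == i) s_ k 0 j @[k --> U] --> (1 : R).
  have -> : (fun k => \sum_(j | owner j == i) s_ k 0 j) = cst 1.
    by apply/funext => k; have [_] := Xs k i.
  exact: cvg_cst.
exact: (@cvg_unique _ (@norm_hausdorff _ R) _ _ _ _ sum_cvg sum1).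
Qed.

End LimitsInSimplex.

(** * Entropy estimates along the iteration *)

Section Convergence.
Variables (R : realType) (N n : nat) (owner : 'I_n -> 'I_N).
Variable v : 'I_N -> 'rV[R]_n -> R.
Implicit Types (i : 'I_N) (j l : 'I_n) (p x : 'rV[R]_n) (k : nat).
Variable g : 'rV[R]_n -> 'I_n -> R.
Hypothesis g_grad : forall pi j, g pi j = grad_comp owner v pi j.
Hypothesis diff_v : forall i pi, in_X owner pi -> differentiable (v i) pi.
Hypothesis mono_v : monotone_game owner v.
Variables (sigma : nat -> 'rV[R]_n) (c b : R).
Hypothesis c0 : 0 < c.
Hypothesis b0 : 0 < b.
Hypothesis interior_sigma : forall k, in_interior_X owner (sigma k).
Hypothesis advantage_sigma : forall k j,
  advantage owner g (sigma k.+1) j <= c * (1 - (sigma k 0 j / sigma k.+1 0 j) `^ b).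

Let X_sigma k : in_X owner (sigma k). Proof. by have [] := interior_sigma k. Qed.
Let sigma_gt0 k j : 0 < sigma k 0 j. Proof. by have [_] := interior_sigma k. Qed.

Definition log_growth k j : R := ln (sigma k.+1 0 j) - ln (sigma k 0 j).

(** The slack in expR (- y) >= 1 - y. It is kept in the entropy decrease in order to force the
    log-ratios to 0. *)
Definition expR_excess (y : R) : R := expR (- y) - 1 + y.

Definition relative_entropy x k : R :=
  \sum_j x 0 j * (ln (x 0 j) - ln (sigma k 0 j)).

Lemma expR_excess_ge0 y : 0 <= expR_excess y.
Proof. by rewrite /expR_excess; have := @expR_ge1Dx R (- y); lra. Qed.

(** An excess below 1 gives y < 2; then 1 - y/2 <= expR (- y/2) can be squared, so the excess is at
    least y^2 / 4. *)
Lemma expR_excess_small y (e : R) : 0 < e ->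
  expR_excess y < Num.min 1 (e ^+ 2 / 4) -> `|y| < e.
Proof.
move=> e0; rewrite lt_min /expR_excess => /andP[y1 ye].
have y2 : y < 2 by have := expR_gt0 (- y); lra.
have : (1 - y / 2) ^+ 2 <= expR (- y).
  have -> : - y = - (y / 2) + - (y / 2) by lra.
  by rewrite expRD -expr2 lerXn2r ?nnegrE ?expR_ge0//; [lra|exact: expR_ge1Dx].
rewrite expr2 => yy; rewrite -(ltr_pXn2r (n := 2)) ?nnegrE// ?(ltW e0)//.
by rewrite real_normK ?num_real// expr2; lra.
Qed.

Lemma sigma_growth k j : sigma k.+1 0 j = sigma k 0 j * expR (log_growth k j).
Proof. by rewrite /log_growth expRB !lnK ?posrE// mulrC divfK// gt_eqF. Qed.

Lemma advantage_le_log_growth k j :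
  advantage owner g (sigma k.+1) j + c * expR_excess (b * log_growth k j) <=
  c * b * log_growth k j.
Proof.
have := advantage_sigma k j; rewrite /powR gt_eqF ?divr_gt0// ln_div ?posrE//.
rewrite /expR_excess /log_growth.
have -> : b * (ln (sigma k 0 j) - ln (sigma k.+1 0 j)) =
  - (b * (ln (sigma k.+1 0 j) - ln (sigma k 0 j))) by ring.
move: (expR _) => E; lra.
Qed.

Lemma relative_entropyB x k : relative_entropy x k.+1 - relative_entropy x k =
  - \sum_j x 0 j * log_growth k j.
Proof.
by rewrite /relative_entropy -sumrB -sumrN; apply: eq_bigr => j _; rewrite /log_growth; ring.
Qed.

(** Average [advantage_le_log_growth] with weights [x]: the log-ratios sum to the entropy decrease,
    the gain rates to the linearised payoff gain. *)
Lemma relative_entropy_step x k : in_X owner x ->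
  c * b * (relative_entropy x k.+1 - relative_entropy x k) +
    c * \sum_j x 0 j * expR_excess (b * log_growth k j) <=
  \sum_j g (sigma k.+1) j * (sigma k.+1 0 j - x 0 j).
Proof.
move=> Xx; have -> : \sum_j g (sigma k.+1) j * (sigma k.+1 0 j - x 0 j) =
    - \sum_j x 0 j * advantage owner g (sigma k.+1) j.
  by rewrite sum_advantage// -sumrN; apply: eq_bigr => j _; ring.
have : 0 <= \sum_j x 0 j * (c * b * log_growth k j -
    (advantage owner g (sigma k.+1) j + c * expR_excess (b * log_growth k j))).
  apply: sumr_ge0 => j _.
  by rewrite mulr_ge0 ?(in_X_ge0 j Xx)// subr_ge0 advantage_le_log_growth.
rewrite (eq_bigr (fun j => c * b * (x 0 j * log_growth k j) -
  x 0 j * advantage owner g (sigma k.+1) j -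
  c * (x 0 j * expR_excess (b * log_growth k j)))); last by move=> j _; ring.
rewrite !sumrB -!mulr_sumr relative_entropyB; lra.
Qed.

Lemma relative_entropy_step_le x k : in_X owner x ->
  c * b * (relative_entropy x k.+1 - relative_entropy x k) <=
  \sum_j g (sigma k.+1) j * (sigma k.+1 0 j - x 0 j).
Proof.
move=> Xx; apply: le_trans (relative_entropy_step k Xx); rewrite lerDl.
rewrite mulr_ge0 ?(ltW c0)//; apply: sumr_ge0 => j _.
by rewrite mulr_ge0 ?(in_X_ge0 j Xx)// expR_excess_ge0.
Qed.

(** A Pinsker-type bound through the Hellinger distance. The linear terms of [entropy_term_ge]
    cancel, both profiles having total mass N, and the two square roots add up to at most 2. *)
Lemma relative_entropy_ge x k j : in_X owner x ->
  (sigma k 0 j - x 0 j) ^+ 2 <= 4 * relative_entropy x k.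
Proof.
move=> Xx.
have : \sum_l (Num.sqrt (x 0 l) - Num.sqrt (sigma k 0 l)) ^+ 2 <= relative_entropy x k.
  have -> : relative_entropy x k = \sum_l (x 0 l * (ln (x 0 l) - ln (sigma k 0 l)) - x 0 l + sigma k 0 l).
    by rewrite !big_split/= sumrN !(in_X_sum (owner := owner))// addrNK.
  by apply: ler_sum => l _; apply: entropy_term_ge => //; exact: (in_X_ge0 l Xx).
rewrite mulrC -ler_pdivrMr//; apply: le_trans.
rewrite (bigD1 j)//= -[leLHS]addr0 lerD//; last by apply: sumr_ge0 => l _; exact: sqr_ge0.
have [x0 x1] := (in_X_ge0 j Xx, in_X_le1 j Xx).
have [s0 s1] := (in_X_ge0 j (X_sigma k), in_X_le1 j (X_sigma k)).
rewrite -{1}(sqr_sqrtr x0) -{1}(sqr_sqrtr s0).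
have sx0 := sqrtr_ge0 (x 0 j); have ss0 := sqrtr_ge0 (sigma k 0 j).
have sx1 : Num.sqrt (x 0 j) <= 1 by rewrite -sqrtr1 ler_wsqrtr.
have ss1 : Num.sqrt (sigma k 0 j) <= 1 by rewrite -sqrtr1 ler_wsqrtr.
move: (Num.sqrt (x 0 j)) (Num.sqrt (sigma k 0 j)) sx0 ss0 sx1 ss1 => y z y0 z0 y1 z1.
have -> : (z ^+ 2 - y ^+ 2) ^+ 2 / 4 = (y - z) ^+ 2 * ((z + y) / 2) ^+ 2 by field.
by rewrite ler_piMr ?sqr_ge0// expr_le1//; lra.
Qed.

Lemma relative_entropy_ge0 x k : in_X owner x -> 0 <= relative_entropy x k.
Proof.
move=> Xx; have [j|n0] := pickP (@predT 'I_n).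
  by move=> _; have := le_trans (sqr_ge0 _) (relative_entropy_ge k j Xx); lra.
by rewrite /relative_entropy big_pred0// => j; have := n0 j.
Qed.

Lemma relative_entropy_near x (e : R) k : in_X owner x -> 0 < e ->
  relative_entropy x k < e ^+ 2 / 4 -> forall j, `|sigma k 0 j - x 0 j| < e.
Proof.
move=> Xx e0 small j; rewrite -(ltr_pXn2r (n := 2)) ?nnegrE// ?(ltW e0)//.
rewrite real_normK ?num_real//; have := relative_entropy_ge k j Xx; lra.
Qed.

(** Monotonicity moves the gradient from the iterate to the fixed point [x]; the result is the
    hypothesis [f_step] of the trapping argument. *)
Lemma relative_entropy_drift x k : in_X owner x ->
  relative_entropy x k.+1 <= relative_entropy x k +
    (c * b)^-1 * \sum_j advantage owner g x j * sigma k.+1 0 j.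
Proof.
move=> Xx; rewrite addrC -lerBlDr ler_pdivlMl ?mulr_gt0//.
apply: le_trans (relative_entropy_step_le k Xx) _.
apply: le_trans (monotone_sum g_grad mono_v Xx (X_sigma k.+1)) _.
rewrite -(sum_advantage g x (X_sigma k.+1)).
by apply: ler_sum => j _; rewrite mulrC.
Qed.

(** Near [x] the gain rate stays above half its value at [x], which bounds the log-ratio below.
    Nearness concerns [k.+1], where the optimality condition evaluates the rate. *)
Lemma advantage_growth x j : in_X owner x -> 0 < advantage owner g x j ->
  exists2 r, 0 < r & exists2 q, 1 < q & forall k,
    (forall l, `|sigma k.+1 0 l - x 0 l| < r) -> q * sigma k 0 j <= sigma k.+1 0 j.
Proof.
move=> Xx adv0; pose d := advantage owner g x j / 2.
have d0 : 0 < d by rewrite divr_gt0.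
have dadv : d < advantage owner g x j by rewrite /d; lra.
have [r r0 lsc] := advantage_lsc g_grad diff_v mono_v Xx dadv.
exists r => //; exists (expR (d / (c * b))).
  by rewrite expR_gt1 divr_gt0// mulr_gt0.
move=> k near; rewrite mulrC sigma_growth ler_pM2l// ler_expR ler_pdivrMr ?mulr_gt0//.
have := lsc _ (X_sigma k.+1) near; have := advantage_le_log_growth k j.
have := mulr_ge0 (ltW c0) (expR_excess_ge0 (b * log_growth k j)); lra.
Qed.

(** * Averages of the iterates and the limit points they provide *)

Let average K : 'rV[R]_n := K.+1%:R^-1 *: \sum_(k < K.+1) sigma k.+1.

Lemma averageE K j : average K 0 j = K.+1%:R^-1 * \sum_(k < K.+1) sigma k.+1 0 j.
Proof. by rewrite mxE summxE. Qed.

Lemma in_X_average K : in_X owner (average K).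
Proof.
move=> i; split=> [j _|].
  by rewrite averageE mulr_ge0 ?invr_ge0 ?ler0n// sumr_ge0// => k _; exact: (in_X_ge0 j (X_sigma _)).
under eq_bigr do rewrite averageE.
rewrite -mulr_sumr exchange_big/= (eq_bigr (fun=> 1)); last first.
  by move=> k _; have [] := X_sigma k.+1 i.
by rewrite sumr_const card_ord mulVf// pnatr_eq0.
Qed.

(** Monotonicity moves the gradient to [p], the entropy steps telescope, and the final entropy is
    nonnegative. *)
Lemma average_minty p K : in_X owner p ->
  \sum_j g p j * (p 0 j - average K 0 j) <= c * b * relative_entropy p 0 / K.+1%:R.
Proof.
move=> Xp; have K0 : 0 < K.+1%:R :> R by rewrite ltr0n.
rewrite ler_pdivlMr//.
have -> : (\sum_j g p j * (p 0 j - average K 0 j)) * K.+1%:R =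
    \sum_(k < K.+1) \sum_j g p j * (p 0 j - sigma k.+1 0 j).
  rewrite exchange_big/= mulr_suml; apply: eq_bigr => j _.
  rewrite -mulr_sumr sumrB sumr_const card_ord averageE -mulrA mulrBl.
  by rewrite mulrAC mulVf ?pnatr_eq0// mul1r mulr_natr.
suff: forall m, \sum_(k < m) \sum_j g p j * (p 0 j - sigma k.+1 0 j) <=
    c * b * (relative_entropy p 0 - relative_entropy p m).
  move=> /(_ K.+1)/le_trans; apply; rewrite ler_wpM2l ?mulr_ge0 ?(ltW c0) ?(ltW b0)//.
  by rewrite gerBl relative_entropy_ge0.
elim=> [|m IH]; first by rewrite big_ord0 subrr mulr0.
rewrite big_ord_recr/=.
have := relative_entropy_step_le m Xp.
have := monotone_sum g_grad mono_v (X_sigma m.+1) Xp.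
have -> : \sum_j g (sigma m.+1) j * (sigma m.+1 0 j - p 0 j) =
   - \sum_j g (sigma m.+1) j * (p 0 j - sigma m.+1 0 j).
  by rewrite -sumrN; apply: eq_bigr => j _; ring.
lra.
Qed.

(** Minty's inequality makes the entropy to [x] nonincreasing and bounded below, so its decrements
    vanish; they control the excess of each coordinate charged by [x]. *)
Lemma log_growth_cvg0 x j : in_X owner x ->
  (forall p, in_X owner p -> \sum_l g p l * (p 0 l - x 0 l) <= 0) ->
  x 0 j != 0 -> log_growth k j @[k --> \oo] --> 0.
Proof.
move=> Xx minty xj0; have xj : 0 < x 0 j by rewrite lt_neqAle eq_sym xj0 (in_X_ge0 j Xx).
have step k : c * b * (relative_entropy x k.+1 - relative_entropy x k) +
    c * (x 0 j * expR_excess (b * log_growth k j)) <= 0.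
  apply: le_trans (le_trans (relative_entropy_step k Xx) (minty _ (X_sigma k.+1))).
  rewrite lerD2l ler_pM2l// (bigD1 j)//= lerDl; apply: sumr_ge0 => l _.
  by rewrite mulr_ge0 ?(in_X_ge0 l Xx)// expR_excess_ge0.
have entropy_decr : nonincreasing_seq (relative_entropy x).
  apply/nonincreasing_seqP => k; rewrite -subr_le0 -(pmulr_rle0 _ (mulr_gt0 c0 b0)).
  apply: le_trans (step k); rewrite lerDl mulr_ge0 ?(ltW c0)//.
  by rewrite mulr_ge0 ?(ltW xj)// expR_excess_ge0.
have entropy_cvg : cvgn (relative_entropy x).
  apply: nonincreasing_is_cvgn => //; exists 0 => _ [k _ <-].
  exact: relative_entropy_ge0.
have diff_cvg : relative_entropy x k - relative_entropy x k.+1 @[k --> \oo] --> 0.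
  rewrite -(subrr (limn (relative_entropy x))); apply: cvgB => //.
  by rewrite (cvg_shiftS (relative_entropy x)).
apply/cvgrPdist_lt => e e0.
have be0 : 0 < b * e by rewrite mulr_gt0.
pose m := Num.min 1 ((b * e) ^+ 2 / 4).
have m0 : 0 < m by rewrite lt_min ltr01 divr_gt0// exprn_gt0.
have thr0 : 0 < x 0 j * m / b by rewrite divr_gt0// mulr_gt0.
near=> k.
rewrite sub0r normrN -(ltr_pM2l b0).
have <- : `|b * log_growth k j| = b * `|log_growth k j| by rewrite normrM gtr0_norm.
apply: expR_excess_small => //; rewrite -(ltr_pM2l xj).
rewrite -/m.
have : relative_entropy x k - relative_entropy x k.+1 < x 0 j * m / b.
  by near: k; exact: (cvgr_lt _ diff_cvg _ thr0).
rewrite ltr_pdivlMr// mulrC; apply: le_lt_trans.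
rewrite -(ler_pM2l c0); have := step k; lra.
Unshelve. all: by end_near. Qed.

Definition off_support_mass x k : R := \sum_(j | x 0 j == 0) sigma k 0 j.

Lemma off_support_mass_ge0 x k : 0 <= off_support_mass x k.
Proof. by apply: sumr_ge0 => j _; exact: (in_X_ge0 j (X_sigma k)). Qed.

Lemma off_support_massE x k :
  off_support_mass x k = N%:R - \sum_(j | x 0 j != 0) sigma k 0 j.
Proof.
by rewrite -(in_X_sum (X_sigma k)) (bigID (fun j => x 0 j == 0))/= addrK.
Qed.

(** Total mass is N, so mass off the support grows only by what the support loses, and there the
    log-ratios tend to 0. *)
Lemma off_support_mass_slow x : in_X owner x ->
  (forall p, in_X owner p -> \sum_l g p l * (p 0 l - x 0 l) <= 0) ->
  forall e, 0 < e -> exists K, forall k, (K <= k)%N ->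
    off_support_mass x k.+1 <= off_support_mass x k + e.
Proof.
move=> Xx minty e e0.
have : \sum_(j | x 0 j != 0) `|log_growth k j| @[k --> \oo] --> \sum_(j | x 0 j != 0) (0 : R).
  apply: cvg_sum_fin => j xj; have := cvg_norm (log_growth_cvg0 Xx minty xj).
  by rewrite normr0; apply.
rewrite big1// => sum_cvg.
have [K _ small] := cvgr_lt _ sum_cvg _ e0.
exists K => k Kk; rewrite !off_support_massE -addrA lerD2l -lerBlDl opprK addrC -sumrB.
apply: le_trans (ltW (small k Kk)); apply: ler_sum => j _.
rewrite sigma_growth; have := expR_ge1Dx (log_growth k j).
have := ler_norm (- log_growth k j); rewrite normrN.
have := sigma_gt0 k j; have := in_X_le1 j (X_sigma k).
have := normr_ge0 (log_growth k j).
move: (log_growth k j) (sigma k 0 j) (expR _) `|log_growth k j| => y s E L L0 s1 s0 yL Ey.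
have : s * (1 - E) <= s * L by rewrite ler_pM2l//; lra.
have : s * L <= L by rewrite ler_piMl.
lra.
Qed.

Lemma relative_entropy_cvg0 (U : set_system nat) (kk : nat -> nat) x : Filter U ->
  in_X owner x -> (forall j, sigma (kk m) 0 j @[m --> U] --> (x 0 j : R)) ->
  relative_entropy x (kk m) @[m --> U] --> 0.
Proof.
move=> FU Xx sx; rewrite /relative_entropy.
rewrite [X in _ --> X](_ : 0 = \sum_(j < n) 0 :> R); last by rewrite big1.
apply: cvg_sum_fin => j _; have [xj|xj] := eqVneq (x 0 j) 0.
  under eq_cvg do rewrite xj mul0r.
  exact: cvg_cst.
have xj0 : 0 < x 0 j by rewrite lt_neqAle eq_sym xj (in_X_ge0 j Xx).
rewrite -[X in _ --> X](mulr0 (x 0 j)) -(subrr (ln (x 0 j))).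
apply: cvgM; first exact: cvg_cst.
apply: cvgB; first exact: cvg_cst.
by apply: (cvg_comp _ _ (sx j)); exact: continuous_ln.
Qed.

Lemma exists_minty_point : exists2 x, in_X owner x &
  (forall p, in_X owner p -> \sum_l g p l * (p 0 l - x 0 l) <= 0) /\
  forall e m, 0 < e -> exists2 k, (m <= k)%N & off_support_mass x k.+1 < e.
Proof.
have [U [FU ooU]] := ultraFilterLemma eventually_filter.
have [x Xx ax] := ultra_simplex_lim FU in_X_average.
have K_cvg (a : R) : a / K.+1%:R @[K --> U] --> 0.
  rewrite -(mulr0 a); apply: cvgM; first exact: cvg_cst.
  exact: cvg_trans (cvg_app _ ooU) (@cvg_harmonic R).
exists x => //; split=> [p Xp|e m e0].
  apply: (@ler_cvg_to _ U _ R (fun K => \sum_l g p l * (p 0 l - average K 0 l)) (fun K => c * b * relative_entropy p 0 / K.+1%:R)).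
  - apply: cvg_sum_fin => l _; apply: cvgM; first exact: cvg_cst.
    by apply: cvgB; [exact: cvg_cst|exact: ax].
  - exact: K_cvg.
  - by apply: filterE => K; exact: average_minty.
apply: contrapT => no_k.
have big k : (m <= k)%N -> e <= off_support_mass x k.+1.
  by move=> mk; rewrite leNgt; apply/negP => small; apply: no_k; exists k.
have mass_cvg : \sum_(j | x 0 j == 0) average K 0 j @[K --> U] --> \sum_(j | x 0 j == 0) x 0 j.
  by apply: cvg_sum_fin => j _; exact: ax.
rewrite [X in _ --> X]big1 in mass_cvg; last by move=> j /eqP.
(* If the mass stayed at least [e] from [m] on, only the first [m] terms of the average could fall
   short. In the limit this contradicts that [x] has no mass there. *)
have mass_ge K : e - m%:R * e / K.+1%:R <= \sum_(j | x 0 j == 0) average K 0 j.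
  have K0 : 0 < K.+1%:R :> R by rewrite ltr0n.
  under eq_bigr do rewrite averageE.
  rewrite -mulr_sumr exchange_big/= ler_pdivlMl// mulrBr mulrCA divff ?gt_eqF// mulr1.
  rewrite -mulrBl.
  suff: forall M, (M%:R - m%:R) * e <= \sum_(k < M) off_support_mass x k.+1 by apply.
  elim=> [|M IH]; first by rewrite big_ord0 sub0r mulNr oppr_le0 mulr_ge0 ?ler0n ?(ltW e0).
  rewrite big_ord_recr/=; have [mM|Mm] := leqP m M.
    by have := big M mM; move: IH; rewrite -natr1; lra.
  apply: (@le_trans _ _ 0); last first.
    by apply: addr_ge0; [apply: sumr_ge0 => k _|]; exact: off_support_mass_ge0.
  by rewrite mulr_le0_ge0 ?(ltW e0)// subr_le0 ler_nat.
have : e <= 0.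
  apply: (@ler_cvg_to _ U _ R (fun K => e - m%:R * e / K.+1%:R) (fun K => \sum_(j | x 0 j == 0) average K 0 j)) => //.
  - rewrite -[X in _ --> X]subr0; apply: cvgB; [exact: cvg_cst|exact: K_cvg].
  - by apply: filterE => K; exact: mass_ge.
by rewrite leNgt e0.
Qed.

(* [x] is found among the limit points of [sigma], and charges only the support of [y], where the log-ratios of [sigma] vanish. *)
Lemma exists_trapping_point : exists y x, [/\ in_X owner y, in_X owner x,
  (forall p, in_X owner p -> \sum_l g p l * (p 0 l - y 0 l) <= 0) & [/\
  (forall j, 0 < advantage owner g x j -> y 0 j = 0),
  (forall j, y 0 j = 0 -> x 0 j = 0) &
  forall e m, 0 < e -> exists2 k, (m <= k)%N & relative_entropy x k < e]].
Proof.
have [y Xy [minty mass_small]] := exists_minty_point.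
have /choice[kk kkP] m : exists k, (m <= k)%N /\ off_support_mass y k.+1 < m.+1%:R^-1.
  by have [|k mk small] := mass_small m.+1%:R^-1 m; [rewrite invr_gt0 ltr0n|exists k].
have [U [FU ooU]] := ultraFilterLemma eventually_filter.
have [x Xx sx] := ultra_simplex_lim FU (fun m => X_sigma (kk m).+1).
exists y, x; split=> //; split.
- move=> j adv0; apply/eqP/negPn/negP => yj.
  (* A positive rate at [x] forces growth by a factor [q > 1] at late times near [x], but on the
     support of [y] the log-ratios eventually stay below [ln q]. *)
  have [r r0 [q q1 grow]] := advantage_growth Xx adv0.
  have q0 : 0 < q by exact: lt_trans q1.
  have [K _ slow] := cvgr_lt _ (log_growth_cvg0 Xy minty yj) _ (ln_gt0 q1).
  have near_x : \forall m \near U, forall l, `|sigma (kk m).+1 0 l - x 0 l| < r.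
    apply: filter_forall => l; have /cvgrPdist_lt/(_ r r0) := sx l.
    by apply: filterS => m; rewrite distrC.
  have late : \forall m \near U, (K <= m)%N by apply: ooU; exists K.
  have [m [/grow] + Km] := filter_ex (filterI near_x late).
  rewrite sigma_growth mulrC ler_pM2l// -ler_ln ?posrE ?expR_gt0// expRK leNgt.
  by move=> /negP; apply; apply: slow => /=; apply: leq_trans Km _; have [] := kkP m.
- move=> j yj; apply/eqP; rewrite eq_le (in_X_ge0 j Xx) andbT.
  apply: (@ler_cvg_to _ U _ R (fun m => sigma (kk m).+1 0 j) (fun m => m.+1%:R^-1)) => //.
    exact: cvg_trans (cvg_app _ ooU) (@cvg_harmonic R).
  apply: filterE => m; have [_ /ltW] := kkP m; apply: le_trans.
  rewrite /off_support_mass (bigD1 j) ?yj//= lerDl; apply: sumr_ge0 => l _.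
  exact: (in_X_ge0 l (X_sigma _)).
- move=> e m e0; have entropy : relative_entropy x (kk k).+1 @[k --> U] --> 0.
    exact: (@relative_entropy_cvg0 U (fun m => (kk m).+1)).
  have small : \forall k \near U, relative_entropy x (kk k).+1 < e.
    exact: (cvgr_lt _ entropy _ e0).
  have late : \forall k \near U, (m <= k)%N by apply: ooU; exists m.
  have [k [ek mk]] := filter_ex (filterI small late).
  exists (kk k).+1 => //; have [kkk _] := kkP k.
  by apply: leq_trans (leq_trans mk kkk) _.
Qed.

Lemma exists_nash_limit : exists2 x, nash owner v x &
  relative_entropy x k @[k --> \oo] --> 0.
Proof.
have [y [x [Xy Xx minty [supp_adv supp_x x_late]]]] := exists_trapping_point.
have trap := @trapping R n (relative_entropy x) (off_support_mass y) (fun k j => sigma k 0 j)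
  (advantage owner g x) (c * b)^-1.
have entropy_small e : 0 < e -> exists K, forall k, (K <= k)%N -> relative_entropy x k < e.
  move=> e0; have [|||||||d d0 [K trapped]] := trap _ _ _ _ _ _ _ e e0.
  - by rewrite invr_ge0 ltW// mulr_gt0.
  - by move=> k j; exact: ltW.
  - by move=> k; exact: relative_entropy_drift.
  - move=> j adv0; have [r r0 [q q1 grow]] := advantage_growth Xx adv0.
    exists (r ^+ 2 / 4); first by rewrite divr_gt0// exprn_gt0.
    by exists q => // k small; apply: grow; exact: relative_entropy_near.
  - move=> k j /supp_adv yj; rewrite /off_support_mass (bigD1 j) ?yj//= lerDl.
    by apply: sumr_ge0 => l _; exact: ltW.
  (* The point [x] vanishes off the support of [y], so each of the at most [n] coordinates there is
     below [r]; dividing by [n.+1] keeps the total strictly below [e'], also for n = 0. *)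
  - move=> e' e'0; pose r := e' / n.+1%:R; have r0 : 0 < r by rewrite divr_gt0 ?ltr0n.
    exists (r ^+ 2 / 4); first by rewrite divr_gt0// exprn_gt0.
    move=> k /(relative_entropy_near Xx r0) near_x.
    apply: (@le_lt_trans _ _ (\sum_(j < n) r)).
      rewrite /off_support_mass big_mkcond/=; apply: ler_sum => j _.
      case: ifP => [/eqP/supp_x xj|_]; last exact: ltW.
      by have := near_x j; rewrite xj subr0 => /ltW; apply: le_trans; exact: ler_norm.
    rewrite sumr_const card_ord -mulr_natr /r mulrAC ltr_pdivrMr ?ltr0n//.
    by rewrite ltr_pM2l// ltr_nat.
  - exact: off_support_mass_slow.
  - have [s Ks sd] := x_late d K d0.
    by exists s => k sk; apply: (trapped s) => //; rewrite Ks.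
exists x; last first.
  apply/cvgrPdist_lt => e e0; have [K small] := entropy_small e e0.
  by exists K => // k /small; rewrite sub0r normrN ger0_norm// relative_entropy_ge0.
apply: (nash_of_advantage g_grad diff_v mono_v Xx) => j; rewrite leNgt; apply/negP => adv0.
(* From some [K] on the iterates remain near [x], so coordinate [j] would grow geometrically for
   ever and exceed 1. *)
have [r r0 [q q1 grow]] := advantage_growth Xx adv0.
have [|K near_x] := entropy_small (r ^+ 2 / 4); first by rewrite divr_gt0// exprn_gt0.
have growth m : q ^+ m * sigma K 0 j <= sigma (K + m) 0 j.
  elim: m => [|m IH]; first by rewrite mul1r addn0.
  rewrite addnS exprS -mulrA; apply: le_trans (grow _ _).
    by rewrite ler_pM2l// (lt_trans ltr01).
  by apply: relative_entropy_near => //; apply: near_x; rewrite -addnS leq_addr.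
have [m big] : exists m : nat, 1 < m%:R * ((q - 1) * sigma K 0 j).
  exists (Num.trunc ((q - 1) * sigma K 0 j)^-1).+1.
  by rewrite -ltr_pdivrMr ?mul1r ?truncnS_gt// mulr_gt0// subr_gt0.
have := le_trans (growth m) (in_X_le1 j (X_sigma _)).
have : (1 + (q - 1) * m%:R) * sigma K 0 j <= q ^+ m * sigma K 0 j.
  by rewrite ler_pM2r// exprn_ge_bernoulli// ltW// (lt_trans ltr01).
have := sigma_gt0 K j; move: big; move: (q ^+ m * _) => Z; nra.
Qed.

Lemma KL_sigma p k : in_X owner p -> KL p (sigma k) = (relative_entropy p k)%:E.
Proof.
move=> Xp; rewrite /KL /relative_entropy -sumEFin; apply: eq_bigr => j _.
rewrite /xlogxy; case: ifPn => [/eqP ->|pj]; first by rewrite mul0r.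
have pj0 : 0 < p 0 j by rewrite lt_neqAle eq_sym pj (in_X_ge0 j Xp).
by rewrite sigma_gt0 ln_div ?posrE.
Qed.

(** The infimum is squeezed between 0 and the divergence from the single equilibrium given by
    [exists_nash_limit]. *)
Lemma KL_nash_set_cvg0 :
  (ereal_inf [set KL p (sigma k) | p in nash_set owner v]) @[k --> \oo] --> 0%E.
Proof.
have [x nash_x entropy_cvg] := exists_nash_limit; have [Xx _] := nash_x.
apply: (@squeeze_cvge _ _ _ _ (fun=> 0%E) _ (fun k => (relative_entropy x k)%:E)).
- apply: filterE => k; apply/andP; split.
    apply: le_ereal_inf_tmp => _ [p [Xp _] <-].
    by rewrite KL_sigma// lee_fin relative_entropy_ge0.
  by apply: ereal_inf_lbound; exists x => //; rewrite KL_sigma.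
- exact: cvg_cst.
- by apply/fine_cvgP; split; [exact: nearW|exact: entropy_cvg].
Qed.

End Convergence.

Theorem theorem9 (R : realType) (N n : nat) (owner : 'I_n -> 'I_N)
  (v : 'I_N -> 'rV[R]_n -> R) (D : divergence R) (mu : R)
  (sigma : nat -> 'rV[R]_n) :
  (0 < N)%N ->
  (forall i pi, in_X owner pi -> differentiable (v i) pi) ->
  monotone_game owner v ->
  alpha_ok D ->
  0 < mu ->
  in_interior_X owner (sigma 0%N) ->
  (forall k, perturbed_eq owner v D mu (sigma k) (sigma k.+1)) ->
  (ereal_inf [set KL p (sigma k) | p in nash_set owner v]) @[k --> \oo] --> 0%E.
Proof.
move=> _ diff_v mono_v alphaD mu0 int0 eq_sigma.
pose g pi j := grad_comp owner v pi j.
have g_grad pi j : g pi j = grad_comp owner v pi j by [].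
move: g g_grad => g g_grad.
have [c c0 [b b0 adv]] := perturbed_eq_advantage g_grad diff_v alphaD mu0.
(* Interiority passes from each anchor to its perturbed equilibrium, so it holds for all
   iterates. *)
have int_sigma k : in_interior_X owner (sigma k).
  by elim: k => // k IH; have [] := adv _ _ IH (eq_sigma k).
apply: (KL_nash_set_cvg0 g_grad diff_v mono_v c0 b0 int_sigma) => k.
by have [_] := adv _ _ (int_sigma k) (eq_sigma k).
Qed.
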